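(* Let $d\in\mathbb{N}$ and let $K_d$ be the integral-min kernel on $[0,1]^d$, $$K_d(x,y)=\int_{[0,1]^d}\Psi_d(x,z)\Psi_d(z,y)\,dz,\qquad \Psi_d(x,y):=\prod_{k=1}^d\big(\min\{x_k,y_k\}-x_ky_k\big),\qquad x,y\in[0,1]^d.$$ Then $K_d$ is the right-sided reproducing kernel of the right-sided reproducing kernel Banach space $\mathcal{B}_{K_d}^1([0,1]^d)$ and the two-sided reproducing kernel of the two-sided reproducing kernel Banach space $\mathcal{B}_{K_d}^p([0,1]^d)$ for $1<p\le\infty$. Moreover, $\mathcal{B}_{K_d}^p([0,1]^d)\subseteq C([0,1]^d)$ for $1\le p\le\infty$.
   Context: For $n=(n_1,\dots,n_d)\in\mathbb{N}^d$ (positive integers) let $$\phi_{d,n}(x):=\prod_{k=1}^d\frac{1}{n_k^2\pi^2}\sqrt2\sin(n_k\pi x_k),\qquad x\in[0,1]^d.$$ One has $K_d(x,y)=\sum_{n\in\mathbb{N}^d}\phi_{d,n}(x)\phi_{d,n}(y)$. For $1\le p<\infty$, $\mathcal{B}_{K_d}^p([0,1]^d):=\{f=\sum_{n\in\mathbb{N}^d}a_n\phi_{d,n}:(a_n)_{n\in\mathbb{N}^d}\in\ell_p\}$ with norm $(\sum_n|a_n|^p)^{1/p}$; and $\mathcal{B}_{K_d}^\infty([0,1]^d):=\{f=\sum_{n\in\mathbb{N}^d}a_n\phi_{d,n}:(a_n)_{n\in\mathbb{N}^d}\in c_0\}$ with norm $\sup_n|a_n|$, where $c_0$ denotes the families tending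 to $0$. Reproducing kernel Banach spaces (here with both domains equal to $\Omega=[0,1]^d$ with Lebesgue measure): $L_0(\Omega)$ denotes the real-valued measurable functions on $\Omega$ (genuine functions). Let $\mathcal{B}$ be a Banach space consisting of functions in $L_0(\Omega)$ whose continuous dual $\mathcal{B}'$ is isometrically isomorphic to a normed space $\mathcal{F}$ consisting of functions in $L_0(\Omega)$, identified with $\mathcal{B}'$; write $\langle f,G\rangle_{\mathcal{B}}:=G(f)$. $\mathcal{B}$ is right-sided with right-sided reproducing kernel $K$ if (i) $K(x,\cdot)\in\mathcal{F}\cong\mathcal{B}'$ for each $x\in\Omega$ and (ii) $\langle f,K(x,\cdot)\rangle_{\mathcal{B}}=f(x)$ for all $f\in\mathcal{B}$, $x\in\Omega$. It is two-sided with two-sided reproducing kernel $K$ if in addition (iii) $K(\cdot,y)\in\mathcal{B}$ for each $y\in\Omega$ and (iv) $\langle K(\cdot,y),g\rangle_{\mathcal{B}}=g(y)$ for all $g\in\mathcal{F}$, $y\in\Omega$. *)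

(* Defs.v *)
From HB Require Import structures.
From mathcomp Require Import all_boot all_order all_algebra.
From mathcomp Require Import all_classical all_reals all_analysis.
From mathcomp Require summability.

Set Implicit Arguments.
Unset Strict Implicit.
Unset Printing Implicit Defensive.

Import Order.TTheory GRing.Theory Num.Theory.
Import numFieldNormedType.Exports.

Local Open Scope classical_set_scope.
Local Open Scope ring_scope.

Section lebesgue_tuple.
Context {R : realType}.
Local Notation T := (measurableTypeR R).

Definition tuple_cons n (z : T * n.-tuple T) : n.+1.-tuple T :=
  [the n.+1.-tuple T of z.1 :: z.2].

(* The product of the one-dimensional Lebesgue measure with a measure on R^n,
   transported to R^(n+1). *)
Definition lebesgue_cons n (m : set (n.-tuple T) -> \bar R) :=
  pushforward (@lebesgue_measure R \x m)%E (@tuple_cons n).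

Section lebesgue_cons_measure.
Variables (n : nat) (m : {sigma_finite_measure set (n.-tuple T) -> \bar R}).

Let mc : measurable_fun setT (@tuple_cons n).
Proof. exact: measurable_cons. Qed.

Let lebesgue_cons0 : lebesgue_cons m set0 = 0%E.
Proof. by rewrite /lebesgue_cons /pushforward preimage_set0 measure0. Qed.

Let lebesgue_cons_ge0 A : (0 <= lebesgue_cons m A)%E.
Proof.
rewrite /lebesgue_cons /pushforward.
exact: (@measure_ge0 _ _ _ (lebesgue_measure \x m)%E).
Qed.

Let lebesgue_cons_sigma_additive : semi_sigma_additive (lebesgue_cons m).
Proof.
move=> F mF tF mUF; rewrite /lebesgue_cons /pushforward preimage_bigcup.
apply: (@measure_semi_sigma_additive _ _ _ (lebesgue_measure \x m)%E).
- by move=> i; rewrite -[X in measurable X]setTI; exact: mc.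
- apply/trivIsetP => /= i j _ _ ij; rewrite -preimage_setI.
  by move/trivIsetP : tF => /(_ _ _ _ _ ij) ->//; rewrite preimage_set0.
- by rewrite -preimage_bigcup -[X in measurable X]setTI; exact: mc.
Qed.

HB.instance Definition _ := isMeasure.Build _ _ _ (lebesgue_cons m)
  lebesgue_cons0 lebesgue_cons_ge0 lebesgue_cons_sigma_additive.

(* product_measure1 has no exported sigma-finite instance, hence the direct
   proof. *)
Let lebesgue_cons_sigma_finite : sigma_finite setT (lebesgue_cons m).
Proof.
have /sigma_finiteP[F [TF ndF Foo]] := sigma_finiteT (@lebesgue_measure R).
have /sigma_finiteP[G [TG ndG Goo]] := sigma_finiteT m.
pose g (z : n.+1.-tuple T) : T * n.-tuple T := (thead z, [tuple of behead z]).
have mg : measurable_fun setT g.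
  by apply: measurable_fun_pair;
    [exact: measurable_tnth|exact: measurable_behead].
have gK : cancel (@tuple_cons n) g.
  by move=> [x y]; congr pair; apply/val_inj.
exists (fun i => g @^-1` (F i `*` G i)).
  rewrite -preimage_bigcup (_ : \bigcup_i _ = setT) ?preimage_setT//.
  rewrite -setXTT TF TG predeqE => -[x y]; split.
    by move=> [i _ []/= ? ?]; split; exists i.
  move=> [/= [i _ Fix] [k _ Gky]]; exists (maxn i k) => //; split.
  - by move: x Fix; exact/subsetPset/ndF/leq_maxl.
  - by move: y Gky; exact/subsetPset/ndG/leq_maxr.
move=> i; have [mF Fi] := Foo i; have [mG Gi] := Goo i; split.
  by rewrite -[X in measurable X]setTI; apply: mg => //; exact: measurableX.
rewrite /lebesgue_cons /pushforward -comp_preimage.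
rewrite (_ : g \o @tuple_cons n = id); last first.
  by apply/funext => z /=; rewrite gK.
by rewrite preimage_id product_measure1E// lte_mul_pinfty// ge0_fin_numE.
Qed.

HB.instance Definition _ := @Measure_isSigmaFinite.Build _ _ _
  (lebesgue_cons m) lebesgue_cons_sigma_finite.
End lebesgue_cons_measure.

(* d-dimensional Lebesgue measure; the product rule below characterizes it. *)
Fixpoint lebesgue_tuple n : {sigma_finite_measure set (n.-tuple T) -> \bar R} :=
  match n with
  | 0 => \d_ [tuple]
  | n'.+1 => lebesgue_cons (lebesgue_tuple n')
  end.

Lemma lebesgue_tuple_box n (A : 'I_n -> set T) :
  (forall i, measurable (A i)) ->
  lebesgue_tuple n [set z | forall i, A i (tnth z i)] =
  (\prod_(i < n) lebesgue_measure (A i))%E.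
Proof.
elim: n A => [|n IH] A mA.
  rewrite big_ord0 /= diracE mem_set//= => -[].
  by [].
rewrite big_ord_recl -IH//= /lebesgue_cons /pushforward.
rewrite (_ : _ @^-1` _ =
  A ord0 `*` [set z | forall i, A (lift ord0 i) (tnth z i)]).
  rewrite product_measure1E//.
  rewrite (_ : [set _ | _] =
    \bigcap_(i in [set: 'I_n]) ((@tnth n T)^~ i @^-1` A (lift ord0 i))).
    apply: fin_bigcap_measurable => // i _.
    by rewrite -[X in measurable X]setTI; exact: measurable_tnth.
  by apply/seteqP; split => z /= Az i => [_|]; exact: Az.
apply/seteqP; split => -[x z] /=.
  move=> Axz; split; first by have := Axz ord0.
  by move=> i; have := Axz (lift ord0 i); rewrite tnthS.
move=> [Ax Az] i; case: (unliftP ord0 i) => [j ->|-> //].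
by rewrite tnthS; exact: Az.
Qed.

End lebesgue_tuple.

Section reproducing_kernel_banach_space.
Context {R : realType} {X : topologicalType}.

(* L_0(X), with X carrying its Borel sigma-algebra. *)
Definition borel_function (f : X -> R) : Prop :=
  forall Y : set R, measurable Y -> <<s @open X >> (f @^-1` Y).

(* A normed (resp. Banach) space consisting of functions in L_0(X): the
   injective linear map to X -> R identifies the elements of the space with
   functions, with pointwise operations; the norm is that of the carrier. *)
Record normed_function_space := NormedFunctionSpace {
  nfs_carrier :> normedModType R ;
  nfs_fun : {linear nfs_carrier -> (X -> R)} ;
  nfs_inj : injective nfs_fun ;
  nfs_borel : forall f, borel_function (nfs_fun f) }.

Record banach_function_space := BanachFunctionSpace {
  bfs_carrier :> completeNormedModType R ;
  bfs_fun : {linear bfs_carrier -> (X -> R)} ;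
  bfs_inj : injective bfs_fun ;
  bfs_borel : forall f, borel_function (bfs_fun f) }.

Definition dual_norm (V : normedModType R) (G : V -> R) : R :=
  sup [set `|G v| | v in [set v : V | `|v| <= 1]].

(* iota is an isometric isomorphism from F onto the continuous dual of V. *)
Definition isometric_onto_dual (V F : normedModType R)
    (iota : F -> {linear V -> R^o}) : Prop :=
  [/\ forall g, continuous (iota g),
      forall (a : R) (g h : F) (v : V),
        iota (a *: g + h) v = a * iota g v + iota h v,
      forall g, dual_norm (iota g) = `|g| &
      forall G : {linear V -> R^o}, continuous G ->
        exists g, forall v, iota g v = G v].

(* The pairing between f in B and g in F is <f, g> = iota g f. Since nfs_fun and
   bfs_fun are injective, the element representing K(x, .) or K(., y) is
   unique. *)
Definition right_reproducing (B : banach_function_space)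
    (F : normed_function_space) (iota : F -> {linear B -> R^o})
    (K : X -> X -> R) : Prop :=
  (forall x, exists g : F, nfs_fun F g = K x) /\
  (forall x (g : F), nfs_fun F g = K x ->
     forall f : B, iota g f = bfs_fun B f x).

Definition left_reproducing (B : banach_function_space)
    (F : normed_function_space) (iota : F -> {linear B -> R^o})
    (K : X -> X -> R) : Prop :=
  (forall y, exists f : B, bfs_fun B f = K^~ y) /\
  (forall y (f : B), bfs_fun B f = K^~ y ->
     forall g : F, iota g f = nfs_fun F g y).

Definition right_sided_RKBS (B : banach_function_space) (K : X -> X -> R) :=
  exists (F : normed_function_space) (iota : F -> {linear B -> R^o}),
    isometric_onto_dual iota /\ right_reproducing iota K.

Definition two_sided_RKBS (B : banach_function_space) (K : X -> X -> R) :=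
  exists (F : normed_function_space) (iota : F -> {linear B -> R^o}),
    [/\ isometric_onto_dual iota, right_reproducing iota K &
        left_reproducing iota K].

End reproducing_kernel_banach_space.

Section sequence_spaces.
Context {R : realType} {I : choiceType}.

(* Membership in l_p for 1 <= p < +oo, and in c_0 (not l_oo) for p = +oo. *)
Definition lp_family (p : \bar R) (a : I -> R) : Prop :=
  match p with
  | r%:E => (\esum_(i in [set: I]) (`|a i| `^ r)%:E < +oo)%E
  | +oo%E => forall e : R, 0 < e -> finite_set [set i | e <= `|a i|]
  | -oo%E => False
  end.

Definition lp_norm (p : \bar R) (a : I -> R) : R :=
  match p with
  | r%:E => fine (\esum_(i in [set: I]) (`|a i| `^ r)%:E) `^ r^-1
  | +oo%E => sup (range (fun i => `|a i|))
  | -oo%E => 0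
  end.

End sequence_spaces.

Section integral_min_kernel.
Context {R : realType}.
Variable d : nat.

Definition unit_cube : set 'rV[R]_d := [set x | forall k, 0 <= x ord0 k <= 1].

(* The type of the points of [0,1]^d, with the subspace topology. *)
Local Notation cube := (set_type unit_cube).

Definition coord (x : cube) (k : 'I_d) : R := set_val x ord0 k.

Definition Psi (x y : 'I_d -> R) : R :=
  \prod_(k < d) (Num.min (x k) (y k) - x k * y k).

Definition integral_min_kernel (x y : cube) : R :=
  \int[lebesgue_tuple d]_(z in [set z | forall k, 0 <= tnth z k <= 1])
    (Psi (coord x) (tnth z) * Psi (tnth z) (coord y)).

(* The multi-index n of positive integers is encoded by m with
   n_k = (m k).+1. *)
Local Notation index := {ffun 'I_d -> nat}.

Definition phi (m : index) (x : cube) : R :=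
  \prod_(k < d) ((((m k).+1%:R) ^+ 2 * pi ^+ 2)^-1 *
    (Num.sqrt 2 * sin ((m k).+1%:R * pi * coord x k))).

(* f = sum_n a_n phi_n pointwise on the cube, as an unordered sum (limit along
   the finite subsets of the index set). *)
Definition expansion (a : index -> R) (f : cube -> R) : Prop :=
  forall x : cube,
    summability.partial_sum (fun m => a m * phi m x) @ summability.totally
      --> f x.

Definition BK_set (p : \bar R) : set (cube -> R) :=
  [set f | exists2 a, lp_family p a & expansion a f].

(* B is the space B_{K_d}^p: its functions are those of BK_set p, and its norm
   is the l_p norm of the coefficients. *)
Definition is_BK (p : \bar R) (B : @banach_function_space R cube) : Prop :=
  range (bfs_fun B) = BK_set p /\
  (forall (f : B) (a : index -> R),
     lp_family p a -> expansion a (bfs_fun B f) -> `|f| = lp_norm p a).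

End integral_min_kernel.

Arguments integral_min_kernel R d x y : clear implicits.
Arguments BK_set {R} d p.
Arguments is_BK {R} d p B.

(* Main.v *)
Require Import Defs.
From HB Require Import structures.
From mathcomp Require Import all_boot all_order all_algebra.
From mathcomp Require Import finmap.
From mathcomp Require Import all_classical all_reals all_analysis.
From mathcomp Require Import measurable_realfun.
From mathcomp Require summability.
From mathcomp Require Import ring lra zify.

(* The space B_K^p is identified with its coefficient space, l_p for finite p
   and c_0 for infinite p. Its dual is never computed as l_q: with
   phi(y) := (phi_n(y))_n, which lies in l_1, a continuous functional G is sent
   to the function y |-> G (phi(y)) = sum_n G(e_n) phi_n(y). This is injective
   because finite families are dense and the sine products are independent.
   The element phi(y) has K(., y) as its function and evaluation at x is the
   functional whose function is K(x, .), so both reproducing properties hold by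
   construction, even for p = 1.

   It remains to expand K_d in the phi_n. By Tonelli K_d is a product of
   one-dimensional kernels, which are differences of values of the quartic
   polynomial with cosine series sum_n cos(n t) / n^4. That series is summed by
   integrating the Dirichlet kernel four times from t = pi, the integration
   constants being determined by the duplication formula. *)

Set Implicit Arguments.
Unset Strict Implicit.
Unset Printing Implicit Defensive.

Import Order.TTheory GRing.Theory Num.Theory.
Import numFieldNormedType.Exports.

Local Open Scope classical_set_scope.
Local Open Scope ring_scope.

#[local] Existing Instance summability.totally_filter.

(** * Sequence spaces *)

(** The sine products decay like prod n_k^-2, uniformly on the cube, so y |-> phi(y) is continuous
    into l_1, and every norm in play is dominated by the l_1 norm. This one fact serves all
    exponents: it gives membership of phi(y), continuity of the functions of both spaces and hence
    their Borel measurability. The obstacle is uniqueness of coefficients. For p = 1 the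
    coefficients G(e_n) of a functional are only bounded, and expansions converge only pointwise.
    Independence is therefore proved for bounded coefficients, with finite sums over a grid: these
    commute with the pointwise limit, and the aliasing they create is controlled by the summable
    majorant. In the cosine series two things impose the base point pi: the Dirichlet kernel
    concentrates at t = 0, so bounds hold only away from 0, and the odd derivatives of the error
    vanish at pi by symmetry. What remains unknown is the value at pi of the error and of its second
    derivative; duplication at two points gives two independent equations for their limits. *)

Lemma cvg_sum_seq {R : realType} {T K : Type} (F : set_system T)
    {FF : Filter F} (r : seq K) (f : K -> T -> R) (l : K -> R) :
  (forall i, f i x @[x --> F] --> l i) ->
  \sum_(i <- r) f i x @[x --> F] --> \sum_(i <- r) l i.
Proof.
move=> fl; elim: r => [|i r IH].
  by rewrite big_nil; under eq_fun do rewrite big_nil; exact: cvg_cst.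
rewrite big_cons; under eq_fun do rewrite big_cons.
by apply: cvgD.
Qed.

Section fset_norm.
Context {R : realType} {I : choiceType}.

Definition restr (J : {fset I}) (a : I -> R) : I -> R :=
  fun i => if i \in J then a i else 0.

(* Seminorms on the finite subfamilies, abstracting the l_r norms and the
   maximum norm; a family belongs to the space when its tails are small, which
   gives c_0 (not all bounded families) in the case of the maximum. *)
Record fset_norm := FsetNorm {
  fsn :> {fset I} -> (I -> R) -> R ;
  fsn_triangle : forall J a b, fsn J (a + b) <= fsn J a + fsn J b ;
  fsn_scale : forall J c a, fsn J (c *: a) = `|c| * fsn J a ;
  fsn_restr : forall (J J' : {fset I}) a, (J `<=` J')%fset ->
    fsn J' (restr J a) = fsn J a ;
  fsn_mono : forall (J J' : {fset I}) a, (J `<=` J')%fset ->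
    fsn J a <= fsn J' a ;
  fsn_set1 : forall i a, fsn [fset i]%fset a = `|a i| }.

Section theory.
Variable N : fset_norm.
Implicit Types (J : {fset I}) (a b : I -> R).

Lemma fsn0 J : N J 0 = 0.
Proof. by rewrite -(scale0r (0 : I -> R)) fsn_scale normr0 mul0r. Qed.

Lemma fsnN J a : N J (- a) = N J a.
Proof. by rewrite -scaleN1r fsn_scale normrN1 mul1r. Qed.

Lemma fsn_ge0 J a : 0 <= N J a.
Proof.
have := fsn_triangle N J a (- a); rewrite subrr fsn0 fsnN -mulr2n.
by rewrite pmulrn_lge0.
Qed.

Lemma fsnU J J' a : N (J `|` J')%fset a <= N J a + N (J' `\` J)%fset a.
Proof.
have -> : N (J `|` J')%fset a =
    N (J `|` J')%fset (restr J a + restr (J' `\` J)%fset a).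
  rewrite -[LHS](fsn_restr N a (fsubset_refl _)); congr (N _ _).
  apply/funext => i; rewrite /restr fctE !inE.
  by case: (i \in J); case: (i \in J'); rewrite ?addr0 ?add0r.
apply: le_trans (fsn_triangle _ _ _ _) _.
rewrite !fsn_restr ?fsubsetUl//.
by apply: fsubset_trans (fsubsetDl _ _) (fsubsetUr _ _).
Qed.

(** Induction on J, adding one point at a time with [fsnU] and [fsn_set1]. The l_1 norm thus
    dominates every such seminorm, which places the absolutely summable families [phi^~ y] in the
    space for each exponent. *)
Lemma fsn_le_sum J a : N J a <= \sum_(i <- J) `|a i|.
Proof.
elim/fset1U_rect: J => [|i J iJ IH].
  by rewrite -(fsn_restr N a (fsubset_refl _)) big_seq_fset0 (_ : restr _ _ = 0) ?fsn0.
rewrite big_fsetU1//= (le_trans (fsnU _ _ _))// fsn_set1 lerD2l.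
by rewrite (le_trans _ IH)// fsn_mono// fsubsetDl.
Qed.

Definition small_tails a : Prop := forall e : R, 0 < e ->
  exists J, forall J', N (J' `\` J)%fset a <= e.

Definition fsn_sup a : R := sup (range (fun J => N J a)).

Lemma fsn_sup_le a M : (forall J, N J a <= M) -> fsn_sup a <= M.
Proof.
move=> aM; apply: ge_sup; first by exists (N fset0 a), fset0.
by move=> _ [J _ <-].
Qed.

Lemma small_tails_bounded a : small_tails a ->
  has_sup (range (fun J => N J a)).
Proof.
move=> /(_ 1 ltr01)[J aJ]; split; first by exists (N fset0 a), fset0.
exists (N J a + 1) => _ [J' _ <-].
have := fsnU J J' a; have := aJ J'.
have := fsn_mono N a (fsubsetUr J J'); lra.
Qed.

Lemma le_fsn_sup a J : small_tails a -> N J a <= fsn_sup a.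
Proof.
move=> /small_tails_bounded aN; apply: (sup_upper_bound aN).
by exists J.
Qed.

Lemma small_tailsP c a b : small_tails a -> small_tails b ->
  small_tails (c *: a + b).
Proof.
move=> ta tb e e0; have c0 : 0 < `|c| + 1 by rewrite ltr_wpDl.
have [J aJ] := ta (e / 2 / (`|c| + 1)) ltac:(by rewrite !divr_gt0).
have [K bK] := tb (e / 2) ltac:(by rewrite divr_gt0).
exists (J `|` K)%fset => L; apply: le_trans (fsn_triangle _ _ _ _) _.
rewrite fsn_scale [leRHS](splitr e); apply: lerD; last first.
  by rewrite (le_trans _ (bK L))// fsn_mono// fsetDS// fsubsetUr.
rewrite (@le_trans _ _ ((`|c| + 1) * (e / 2 / (`|c| + 1))))//; last first.
  by rewrite mulrC divfK// gt_eqF.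
rewrite ler_pM ?fsn_ge0 ?lerDl//.
by rewrite (le_trans _ (aJ L))// fsn_mono// fsetDS// fsubsetUl.
Qed.

Lemma small_tails_restr J a : small_tails (restr J a).
Proof.
move=> e e0; exists J => J'; rewrite (le_trans _ (ltW e0))//.
rewrite (le_trans (fsn_le_sum _ _))// big_seq big1// => i.
by rewrite !inE /restr => /andP[/negbTE->]; rewrite normr0.
Qed.

Definition small_tails_pred : {pred I -> R} := mem [set a | small_tails a].

Lemma small_tails_submod : submod_closed small_tails_pred.
Proof.
split=> [|c a b]; rewrite !inE; last exact: small_tailsP.
by move=> e e0; exists fset0 => J; rewrite fsn0 ltW.
Qed.

HB.instance Definition _ := GRing.isSubmodClosed.Build _ _ small_tails_pred
  small_tails_submod.

Record seqspace := SeqSpace {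
  coefs :> I -> R ; coefsP : coefs \in small_tails_pred }.

HB.instance Definition _ := [isSub for coefs].
HB.instance Definition _ := [Choice of seqspace by <:].
HB.instance Definition _ := [SubChoice_isSubLmodule of seqspace by <:].

Lemma small_tails_coefs (a : seqspace) : small_tails a.
Proof. by have := coefsP a; rewrite inE. Qed.

Let fsn_supD (a b : seqspace) : fsn_sup (a + b : seqspace) <= fsn_sup a + fsn_sup b.
Proof.
apply: fsn_sup_le => J; rewrite (le_trans (fsn_triangle _ _ _ _))//.
by rewrite lerD// le_fsn_sup//; exact: small_tails_coefs.
Qed.

Let fsn_supZ c (a : seqspace) : fsn_sup (c *: a : seqspace) = `|c| * fsn_sup a.
Proof.
have le1 k (b : seqspace) : fsn_sup (k *: b : seqspace) <= `|k| * fsn_sup b.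
  apply: fsn_sup_le => J; rewrite fsn_scale ler_wpM2l// le_fsn_sup//.
  exact: small_tails_coefs.
apply/eqP; rewrite eq_le le1/=; have [->|c0] := eqVneq c 0.
  rewrite normr0 mul0r (le_trans (fsn_ge0 fset0 (0 *: a : seqspace)))//.
  by rewrite le_fsn_sup//; exact: small_tails_coefs.
rewrite mulrC -ler_pdivlMr ?normr_gt0// mulrC -normfV.
have := le1 c^-1 (c *: a : seqspace).
by rewrite scalerA mulVf// scale1r.
Qed.

Let fsn_sup0_eq0 (a : seqspace) : fsn_sup a = 0 -> a = 0.
Proof.
move=> a0; apply/val_inj/funext => i; apply/eqP; rewrite -normr_le0/=.
rewrite -[leRHS]a0 -(fsn_set1 N) le_fsn_sup//; exact: small_tails_coefs.
Qed.

HB.instance Definition _ := Lmodule_isNormed.Build R seqspace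
  fsn_supD fsn_supZ fsn_sup0_eq0.

Lemma seqspace_normE (a : seqspace) : `|a| = fsn_sup a.
Proof. by []. Qed.

Lemma ler_coef_norm (a : seqspace) i : `|a i| <= `|a|.
Proof.
rewrite -(fsn_set1 N) seqspace_normE le_fsn_sup//; exact: small_tails_coefs.
Qed.

Lemma coefsB (a b : seqspace) i : (a - b) i = a i - b i.
Proof. by []. Qed.

Lemma seqspace_complete (F : set_system seqspace) :
  ProperFilter F -> cauchy F -> cvg F.
Proof.
move=> FF /cauchyP Fc.
have Fball e : 0 < e -> exists a : seqspace, F [set b | `|a - b| < e].
  by move=> /Fc[a Fa]; exists a; rewrite -ball_normE in Fa.
have Fi i : cvg ((fun b : seqspace => b i) @ F).
  apply: cauchy_cvg; apply: cauchy_exP => e /Fball[a Fa].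
  exists (a i); rewrite -ball_normE.
  suff : F [set b | `|a i - b i| < e] by [].
  by apply: filterS Fa => b /=; apply: le_lt_trans; exact: (ler_coef_norm (a - b)).
pose l i := lim ((fun b : seqspace => b i) @ F).
(* On a fixed finite J the seminorm is controlled by finitely many coordinates, so the bound passes
   to the coordinatewise limit [l], with the same e for all J. *)
have al (a : seqspace) e : F [set b | `|a - b| < e] ->
    forall J, N J ((a : I -> R) - l) <= e.
  move=> Fae J; apply/ler_addgt0Pr => d d0.
  have sumJ : (fun u : seqspace => \sum_(i <- J) `|u i - l i|) @ F --> (0 : R).
    have := @cvg_sum_seq R seqspace I F _ J
      (fun i (b : seqspace) => `|b i - l i|) (cst 0).
    rewrite big1//; apply => i; rewrite /cst -(normr0 R) -(subrr (l i)).
    by apply: cvg_norm; apply: cvgB; [exact: Fi|exact: cvg_cst].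
  have /cvgr_dist_lt/(_ _ d0) Fd := sumJ.
  have [b [/= ab]] := filter_ex (filterI Fae Fd).
  rewrite sub0r normrN ger0_norm ?sumr_ge0// => bl.
  have -> : (a : I -> R) - l = ((a - b : seqspace) : I -> R) + ((b : I -> R) - l).
    by apply/funext => i; rewrite !fctE/= addrA subrK.
  rewrite (le_trans (fsn_triangle _ _ _ _))// lerD//.
    rewrite (le_trans _ (ltW ab))// seqspace_normE le_fsn_sup//.
    exact: small_tails_coefs.
  exact: le_trans (fsn_le_sum _ _) (ltW bl).
have tl : small_tails l.
  move=> e e0; have e20 : 0 < e / 2 by rewrite divr_gt0.
  have [a Fa] := Fball _ e20.
  have [J aJ] := small_tails_coefs a e20.
  exists J => J'; have -> : l = (a : I -> R) - ((a : I -> R) - l).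
    by rewrite opprB addrC subrK.
  rewrite (le_trans (fsn_triangle _ _ _ _))// fsnN [leRHS]splitr lerD//.
  exact: al Fa _.
have lP : l \in small_tails_pred by rewrite inE.
apply/cvg_ex; exists (SeqSpace lP); apply/cvgrPdist_le => e e0.
have e20 : 0 < e / 2 by rewrite divr_gt0.
have [a Fa] := Fball _ e20; apply: filterS (Fa) => b /= ab.
rewrite -(subrK a (SeqSpace lP)) -addrA (le_trans (ler_normD _ _))//.
rewrite [leRHS]splitr lerD ?(ltW ab)// distrC seqspace_normE.
by apply: fsn_sup_le => J; exact: al Fa _.
Qed.

HB.instance Definition _ := Uniform_isComplete.Build seqspace
  seqspace_complete.

Definition seq_restr (J : {fset I}) a : seqspace :=
  SeqSpace (mem_set (@small_tails_restr J a)).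

(** Restricting to K leaves only the tail outside K, hence outside J. This density of the finite
    families would fail for l_oo, and it is what lets a functional be recovered from its values on
    unit vectors. *)
Lemma seq_restr_cvg (a : seqspace) e : 0 < e ->
  exists J, forall K, (J `<=` K)%fset -> `|a - seq_restr K a| <= e.
Proof.
move=> /(small_tails_coefs a)[J aJ]; exists J => K JK.
rewrite seqspace_normE; apply: fsn_sup_le => J'.
rewrite (le_trans _ (aJ J'))//.
rewrite (le_trans _ (fsn_mono N a (fsetDS J' JK)))//.
rewrite -[leRHS](fsn_restr N _ (fsubsetDl J' K)).
rewrite -(fsn_restr N _ (fsubset_refl J')) le_eqVlt; apply/orP; left; apply/eqP.
congr (N _ _); apply/funext => i; rewrite /restr coefsB /= /restr !inE.
by case: (i \in K); rewrite ?subrr ?subr0 //= if_same.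
Qed.

End theory.
End fset_norm.

(** * Dual spaces *)

Section dual_space.
Context {R : realType}.
Variable V : normedModType R.

Definition dual_pred : {pred V -> R^o} :=
  mem [set G : V -> R^o | linear G /\ continuous G].

Lemma dual_submod : submod_closed dual_pred.
Proof.
split=> [|c G H]; rewrite !inE /=.
  by split=> [k u v|u]; [rewrite scaler0 addr0|exact: cvg_cst].
move=> [lG cG] [lH cH]; split=> [k u v|u].
  change (c *: G (k *: u + v) + H (k *: u + v) =
    k *: (c *: G u + H u) + (c *: G v + H v)).
  by rewrite lG lH !scalerDr !scalerA (mulrC c k) !addrA (addrAC (_ *: _)).
by apply: cvgD; [apply: cvgZr; exact: cG|exact: cH].
Qed.

HB.instance Definition _ := GRing.isSubmodClosed.Build _ _ dual_pred
  dual_submod.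

Record dual := Dual {
  dual_fun :> V -> R^o ; dualP : dual_fun \in dual_pred }.

HB.instance Definition _ := [isSub for dual_fun].
HB.instance Definition _ := [Choice of dual by <:].
HB.instance Definition _ := [SubChoice_isSubLmodule of dual by <:].

Lemma dual_linear (G : dual) : linear G.
Proof. by have := dualP G; rewrite inE => -[]. Qed.

Lemma dual_continuous (G : dual) : continuous G.
Proof. by have := dualP G; rewrite inE => -[]. Qed.

Definition dual_lin (G : dual) : {linear V -> R^o} :=
  HB.pack (dual_fun G) (GRing.isLinear.Build _ _ _ _ _ (dual_linear G)).

Lemma dual0 (G : dual) : G 0 = 0. Proof. exact: (linear0 (dual_lin G)). Qed.

Lemma dualZ (G : dual) c v : G (c *: v) = c * G v.
Proof. exact: (linearZ_LR (dual_lin G)). Qed.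

Lemma dualD (G : dual) v w : G (v + w) = G v + G w.
Proof. exact: (linearD (dual_lin G)). Qed.

Lemma dual_bounded (G : dual) :
  exists2 C, 0 <= C & forall v, `|G v| <= C * `|v|.
Proof.
have /linear_boundedP : bounded_near (dual_lin G) (nbhs (0 : V)).
  exact/linear_bounded_continuous/dual_continuous.
move=> [M [Mreal GM]]; exists (`|M| + 1); first by rewrite addr_ge0.
by apply: GM; rewrite (le_lt_trans (ler_norm _))// ltrDl.
Qed.

Let has_sup_dual (G : dual) : has_sup [set `|G v| | v in [set v : V | `|v| <= 1]].
Proof.
split; first by exists `|G 0|, 0 => //=; rewrite normr0.
have [C C0 GC] := dual_bounded G; exists C => _ [v /= v1 <-].
by rewrite (le_trans (GC v))// ler_piMr.
Qed.

Lemma le_dual_norm (G : dual) v : `|G v| <= dual_norm G * `|v|.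
Proof.
have [->|v0] := eqVneq v 0; first by rewrite dual0 !normr0 mulr0.
rewrite -ler_pdivrMr ?normr_gt0//.
have -> : `|G v| / `|v| = `|G (`|v|^-1 *: v)|.
  by rewrite dualZ normrM normfV normr_id mulrC.
apply: (sup_upper_bound (has_sup_dual G)); exists (`|v|^-1 *: v) => //=.
by rewrite normrZ normfV normr_id mulVf ?normr_eq0.
Qed.

Lemma dual_norm_le (G : dual) M : 0 <= M ->
  (forall v, `|G v| <= M * `|v|) -> dual_norm G <= M.
Proof.
move=> M0 GM; apply: ge_sup; first by case: (has_sup_dual G).
by move=> _ [v /= v1 <-]; rewrite (le_trans (GM v))// ler_piMr.
Qed.

Lemma dual_norm_ge0 (G : dual) : 0 <= dual_norm G.
Proof.
rewrite (@le_trans _ _ `|G 0|)//; apply: (sup_upper_bound (has_sup_dual G)).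
by exists 0 => //=; rewrite normr0.
Qed.

Let nrm (G : dual) := dual_norm G.

Let dual_normD (G H : dual) : nrm (G + H) <= nrm G + nrm H.
Proof.
apply: dual_norm_le => [|v]; first by rewrite addr_ge0 ?dual_norm_ge0.
by rewrite mulrDl (le_trans (ler_normD _ _))// lerD ?le_dual_norm.
Qed.

Let dual_normZ c (G : dual) : nrm (c *: G) = `|c| * nrm G.
Proof.
have le1 k (H : dual) : nrm (k *: H) <= `|k| * nrm H.
  apply: dual_norm_le => [|v]; first by rewrite mulr_ge0 ?dual_norm_ge0.
  by rewrite normrM -mulrA ler_wpM2l// le_dual_norm.
apply/eqP; rewrite eq_le le1/=; have [->|c0] := eqVneq c 0.
  by rewrite normr0 mul0r; exact: dual_norm_ge0.
rewrite mulrC -ler_pdivlMr ?normr_gt0// mulrC -normfV.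
by have := le1 c^-1 (c *: G); rewrite scalerA mulVf// scale1r.
Qed.

Let dual_norm0_eq0 (G : dual) : nrm G = 0 -> G = 0.
Proof.
move=> G0; apply/val_inj/funext => v; apply/eqP; rewrite -normr_le0/=.
by rewrite (le_trans (le_dual_norm _ _))// [dual_norm _]G0 mul0r.
Qed.

HB.instance Definition _ := Lmodule_isNormed.Build R dual
  dual_normD dual_normZ dual_norm0_eq0.

(** Immediate because the second space is the dual itself under its operator norm; the substance
    lies in realizing functionals as functions, injectively, through [dual_value]. *)
Lemma isometric_onto_dual_lin : isometric_onto_dual dual_lin.
Proof.
split=> //; first by move=> G; exact: dual_continuous.
move=> G cG; suff GP : (G : V -> R^o) \in dual_pred by exists (Dual GP).
by rewrite inE; split=> // k u v; rewrite linearP.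
Qed.

End dual_space.

(** * Borel measurability of continuous functions *)

Section borel.
Context {R : realType} {X : topologicalType}.

Lemma continuous_borel_function (f : X -> R) : continuous f -> borel_function f.
Proof.
move=> /continuousP cf Y mY.
have : (@measurable_realfun.RGenOpens.G R).-sigma.-measurable Y.
  by rewrite -measurable_realfun.RGenOpens.measurableE.
suff : <<s @measurable_realfun.RGenOpens.G R >> `<=`
    image_set_system setT f <<s @open X >>.
  by move=> /[apply]; rewrite /image_set_system /= setTI.
apply: smallest_sub => [|_ [x [y ->]]].
  exact/sigma_algebra_image/smallest_sigma_algebra.
rewrite /image_set_system /= setTI.
by apply: sub_sigma_algebra; apply: cf; exact: interval_open.
Qed.
End borel.

(** * Unordered sums *)

Section unordered_sum.
Context {R : realType} {I : choiceType}.
Implicit Types (c : I -> R) (J : {fset I}).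

Local Notation totally := (@summability.totally I).

Lemma partial_sumE c J : summability.partial_sum c J = \sum_(i <- J) c i.
Proof. by rewrite (big_seq_fsetE _ _ predT). Qed.

Definition abs_summable c : Prop :=
  exists M, forall J, \sum_(i <- J) `|c i| <= M.

Lemma nearE_totally (P : {fset I} -> Prop) :
  (\forall J \near totally, P J) <-> exists J, forall K, (J `<=` K)%fset -> P K.
Proof. by split=> [[J _ JP]|[J JP]]; exists J. Qed.

Lemma sum_fset_subD c J K : (J `<=` K)%fset ->
  \sum_(i <- K) c i = \sum_(i <- J) c i + \sum_(i <- (K `\` J)%fset) c i.
Proof.
move=> JK; rewrite (big_fsetID _ (mem J))/=; congr (_ + _).
  apply: eq_fbig => // i; rewrite !inE /=.
  by apply/andP/idP => [[]//|iJ]; rewrite (fsubsetP JK).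
by apply: eq_fbig => // i; rewrite !inE /= andbC.
Qed.

(** J nearly attains the supremum of the finite sums of |c i|; whatever lies outside J can add at
    most the missing e. *)
Lemma abs_summable_tail c (e : R) : abs_summable c -> 0 < e ->
  exists J, forall K, \sum_(i <- (K `\` J)%fset) `|c i| <= e.
Proof.
move=> [M cM] e0; pose S := range (fun J => \sum_(i <- J) `|c i|).
have hS : has_sup S.
  by split; [exists (\sum_(i <- fset0) `|c i|), fset0|exists M => _ [J _ <-]].
have [_ [J _ <-] Je] := sup_adherent e0 hS; exists J => K.
have : \sum_(i <- (J `|` K)%fset) `|c i| <= sup S.
  by apply: (sup_upper_bound hS); exists (J `|` K)%fset.
rewrite (sum_fset_subD _ (fsubsetUl J K)).
have -> : ((J `|` K) `\` J = K `\` J)%fset by rewrite fsetDUl fsetDv fset0U.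
lra.
Qed.

Lemma abs_summable_cvg c : abs_summable c ->
  cvg (summability.partial_sum c @ totally).
Proof.
move=> sc; apply: cauchy_cvg; apply: cauchy_exP => e e0.
have [J Je] := abs_summable_tail sc (ltac:(by rewrite divr_gt0) : 0 < e / 2).
exists (summability.partial_sum c J); exists J => // K /= JK.
rewrite /ball/= !partial_sumE (sum_fset_subD c JK) opprD addrA subrr add0r normrN.
rewrite (le_lt_trans (ler_norm_sum _ _ _))// (le_lt_trans (Je K))//; lra.
Qed.

Lemma cvg_partial_sum c : abs_summable c ->
  summability.partial_sum c @ totally --> (summability.sum c : R).
Proof. exact: abs_summable_cvg. Qed.

Lemma partial_sum_cvg_eq c (l : R) :
  summability.partial_sum c @ totally --> l -> summability.sum c = l.
Proof. by move=> cl; apply: cvg_lim. Qed.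

Lemma partial_sumZD k c c' (l l' : R) :
  summability.partial_sum c @ totally --> l ->
  summability.partial_sum c' @ totally --> l' ->
  summability.partial_sum (fun i => k * c i + c' i) @ totally --> k * l + l'.
Proof.
move=> cl cl'.
have -> : summability.partial_sum (fun i => k * c i + c' i) =
    fun J => k * summability.partial_sum c J + summability.partial_sum c' J.
  by apply/funext => J; rewrite !partial_sumE mulr_sumr -big_split.
apply: (@cvgD _ _ _ _ _ (fun J => k * summability.partial_sum c J)) => //.
exact: cvgMl_tmp.
Qed.

Lemma partial_sum_le c (l M : R) : (forall J, `|\sum_(i <- J) c i| <= M) ->
  summability.partial_sum c @ totally --> l -> `|l| <= M.
Proof.
move=> cM /cvg_norm; move=> /cvgr_to_le; apply.
by near=> J; rewrite partial_sumE.
Unshelve. all: by end_near. Qed.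

Lemma abs_summable_bounded c b (M : R) : abs_summable c ->
  (forall i, `|b i| <= M) -> abs_summable (fun i => b i * c i).
Proof.
move=> [C cC] bM; exists (`|M| * C) => J.
rewrite (@le_trans _ _ (\sum_(i <- J) `|M| * `|c i|))//; last first.
  by rewrite -mulr_sumr ler_wpM2l.
apply: ler_sum => i _; rewrite normrM ler_wpM2r//.
by rewrite (le_trans (bM i))// ler_norm.
Qed.

End unordered_sum.

(** * Spaces of expansions *)

Section expansion_space.
Context {R : realType} {I : choiceType} {X : topologicalType}.
Variables (N : @fset_norm R I) (phi : I -> X -> R).

Definition expands (a : I -> R) (f : X -> R) : Prop := forall x,
  summability.partial_sum (fun i => a i * phi i x) @ summability.totally --> f x.

Hypothesis phi_summable : forall x, abs_summable (phi^~ x).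
(** Bounding all finite sums by the same e expresses continuity of y |-> phi(y) for the l_1 norm
    without naming that norm. *)
Hypothesis phi_continuous : forall x (e : R), 0 < e ->
  \forall y \near x, forall J : {fset I}, \sum_(i <- J) `|phi i x - phi i y| <= e.
Hypothesis phi_independent : forall (a : I -> R) (M : R),
  (forall i, `|a i| <= M) -> expands a (cst 0) -> a = 0.

Local Notation B := (seqspace N).
Implicit Types (a b : B) (G : dual B).

Definition value (a : I -> R) (x : X) : R :=
  summability.sum (fun i => a i * phi i x).

Lemma value_abs_summable (a : I -> R) (M : R) x : (forall i, `|a i| <= M) ->
  abs_summable (fun i => a i * phi i x).
Proof. by move=> aM; apply: abs_summable_bounded aM. Qed.

Lemma expands_value (a : I -> R) (M : R) : (forall i, `|a i| <= M) ->
  expands a (value a).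
Proof. by move=> aM x; apply: cvg_partial_sum; apply: value_abs_summable aM. Qed.

Lemma expandsZD k (a b : I -> R) (f g : X -> R) : expands a f -> expands b g ->
  expands (k *: a + b) (k *: f + g).
Proof.
move=> af bg x; rewrite (_ : (fun _ => _) =
    fun i => k * (a i * phi i x) + b i * phi i x); last first.
  by apply/funext => i; rewrite -[(k *: a + b) i]/(k * a i + b i); ring.
exact: partial_sumZD.
Qed.

Lemma expands_uniq_coef (a b : I -> R) (f : X -> R) (M M' : R) :
  (forall i, `|a i| <= M) -> (forall i, `|b i| <= M') ->
  expands a f -> expands b f -> a = b.
Proof.
move=> aM bM af bf; suff ab : -1 *: b + a = 0.
  by move: ab; rewrite scaleN1r addrC => /subr0_eq.
apply: (@phi_independent _ (M' + M)) => [i|x].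
  rewrite -[(-1 *: b + a) i]/(-1 * b i + a i) mulN1r.
  by rewrite (le_trans (ler_normD _ _))// normrN lerD.
have := @expandsZD (-1) _ _ _ _ bf af x.
rewrite -[(-1 *: f + f) x]/(-1 * f x + f x) (_ : -1 * f x + f x = 0)//.
by ring.
Qed.

Lemma value_linear : linear (value : B -> (X -> R)).
Proof.
move=> k a b; apply/funext => x; apply: partial_sum_cvg_eq.
exact: (@expandsZD k _ _ _ _ (expands_value (ler_coef_norm a))
  (expands_value (ler_coef_norm b))).
Qed.

Definition value_lin : {linear B -> (X -> R)} :=
  HB.pack (value : B -> (X -> R)) (GRing.isLinear.Build _ _ _ _ _ value_linear).

Lemma value_inj : injective value_lin.
Proof.
move=> a b ab; apply/val_inj => /=.
have ea := expands_value (ler_coef_norm a).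
apply: (expands_uniq_coef (ler_coef_norm a) (ler_coef_norm b) ea).
have -> : value a = value b by exact: ab.
exact: expands_value (ler_coef_norm b).
Qed.

(** The bound of [phi_continuous] is uniform in the finite set, so it survives the limit; bounded
    coefficients cost only the factor |M| + 1, where the 1 keeps the divisor positive. *)
Lemma expands_continuous (a : I -> R) (M : R) (f : X -> R) :
  (forall i, `|a i| <= M) -> expands a f -> continuous f.
Proof.
move=> aM af x; apply/cvgrPdist_le => e e0.
have M0 : 0 < `|M| + 1 by rewrite ltr_wpDl.
have := phi_continuous x (divr_gt0 e0 M0); apply: filterS => y xy.
have := @partial_sumZD _ _ (-1) _ _ _ _ (af y) (af x); rewrite mulN1r addrC.
apply: partial_sum_le => J.
rewrite (le_trans (ler_norm_sum _ _ _))//.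
rewrite (@le_trans _ _ (\sum_(i <- J) (`|M| + 1) * `|phi i x - phi i y|))//.
  apply: ler_sum => i _; rewrite mulN1r addrC -mulrBr normrM ler_wpM2r//.
  by rewrite (le_trans (aM i))// (le_trans (ler_norm _))// lerDl.
by rewrite -mulr_sumr mulrC -ler_pdivlMr.
Qed.

Definition expansion_space : @banach_function_space R X :=
  BanachFunctionSpace value_inj (fun a : B => continuous_borel_function
    (expands_continuous (ler_coef_norm a) (expands_value (ler_coef_norm a)))).

Lemma small_tails_phi y : small_tails N (phi^~ y).
Proof.
move=> e /(abs_summable_tail (phi_summable y))[J Je]; exists J => K.
exact: le_trans (fsn_le_sum _ _ _) (Je K).
Qed.

Definition phi_seq y : B := SeqSpace (mem_set (small_tails_phi y)).

Lemma phi_seq_continuous : continuous phi_seq.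
Proof.
move=> x; apply/cvgrPdist_le => e /(phi_continuous x).
apply: filterS => y xy; rewrite seqspace_normE; apply: fsn_sup_le => J.
exact: le_trans (fsn_le_sum _ _ _) (xy J).
Qed.

Definition unit_seq i : B := seq_restr N [fset i]%fset (cst 1).

Lemma seq_restr_sum J (a : I -> R) :
  seq_restr N J a = \sum_(i <- J) a i *: unit_seq i.
Proof.
apply/val_inj/funext => j /=.
have -> : val (\sum_(i <- J) a i *: unit_seq i) j =
    \sum_(i <- J) a i * (unit_seq i j).
  elim: (enum_fset J) => [|i r IH]; first by rewrite !big_nil.
  by rewrite !big_cons -IH.
rewrite /= /restr; case: ifPn => [jJ|jJ].
  rewrite (big_fsetD1 j)//= /unit_seq/= /restr inE eqxx mulr1 big_seq big1 ?addr0//.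
  by move=> i; rewrite !inE => /andP[/negbTE ij _]; rewrite eq_sym ij mulr0.
rewrite big_seq big1// => i iJ; rewrite /unit_seq/= /restr inE.
by case: eqP => [ji|]; [rewrite ji iJ in jJ|rewrite mulr0].
Qed.

(** G is bounded and the finite restrictions of a converge to a in norm. No conjugate exponent
    enters, so l_1, l_p and c_0 are treated alike. *)
Lemma dual_expansion G a :
  summability.partial_sum (fun i => a i * G (unit_seq i)) @ summability.totally
    --> (G a : R).
Proof.
apply/cvgrPdist_le => e e0; have [C C0 GC] := dual_bounded G.
have C1 : 0 < C + 1 by rewrite ltr_wpDl.
have [J Je] := seq_restr_cvg a (divr_gt0 e0 C1).
exists J => // K /= /Je aK; rewrite partial_sumE.
have -> : \sum_(i <- K) a i * G (unit_seq i) = G (seq_restr N K a).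
  rewrite seq_restr_sum; elim: (enum_fset K) => [|i r IH].
    by rewrite !big_nil dual0.
  by rewrite !big_cons dualD dualZ IH.
rewrite -mulN1r -dualZ -dualD scaleN1r (le_trans (GC _))//.
rewrite (@le_trans _ _ ((C + 1) * (e / (C + 1))))//; last first.
  by rewrite mulrC divfK// gt_eqF.
by rewrite ler_pM// lerDl.
Qed.

(* As a function, a functional is determined by its values on the phi_seq x,
   since its coefficients are recovered by phi_independent. *)
Definition dual_value G (x : X) : R := G (phi_seq x).

Lemma unit_seq_norm i : `|unit_seq i| <= 1.
Proof.
rewrite seqspace_normE; apply: fsn_sup_le => J.
rewrite (le_trans (fsn_mono N _ (fsubsetUr [fset i]%fset J)))//.
rewrite fsn_restr ?fsubsetUl// fsn_set1 normr1//.
Qed.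

Lemma expands_dual_value G : expands (fun i => G (unit_seq i)) (dual_value G).
Proof.
move=> x; rewrite (_ : (fun _ => _) = fun i => phi_seq x i * G (unit_seq i)).
  exact: dual_expansion.
by apply/funext => i; rewrite mulrC.
Qed.

Lemma dual_value_linear : linear (dual_value : dual B -> (X -> R)).
Proof. by []. Qed.

Definition dual_value_lin : {linear dual B -> (X -> R)} :=
  HB.pack (dual_value : dual B -> (X -> R))
    (GRing.isLinear.Build _ _ _ _ _ dual_value_linear).

Lemma dual_coef_bounded G : exists M, forall i, `|G (unit_seq i)| <= M.
Proof.
have [C C0 GC] := dual_bounded G; exists C => i.
by rewrite (le_trans (GC _))// ler_piMr// unit_seq_norm.
Qed.

Lemma dual_value_inj : injective dual_value_lin.
Proof.
move=> G H GH; have [M GM] := dual_coef_bounded G.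
have [M' HM'] := dual_coef_bounded H.
have eG := @expands_dual_value G.
have eH : expands (fun i => H (unit_seq i)) (dual_value G).
  have -> : dual_value G = dual_value H by exact: GH.
  exact: expands_dual_value.
have GHe := expands_uniq_coef GM HM' eG eH.
apply/val_inj/funext => a /=; rewrite -(partial_sum_cvg_eq (@dual_expansion G a)).
rewrite -(partial_sum_cvg_eq (@dual_expansion H a)); congr (summability.sum _).
by apply/funext => i; rewrite -[G _]/((fun i => G (unit_seq i)) i) GHe.
Qed.

Lemma dual_value_continuous G : continuous (dual_value G).
Proof.
move=> x; apply: continuous_comp; first exact: phi_seq_continuous.
exact: dual_continuous.
Qed.

Definition dual_expansion_space : @normed_function_space R X :=
  NormedFunctionSpace dual_value_inj
    (fun G : dual B => continuous_borel_function (@dual_value_continuous G)).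

Lemma evaluation_linear x : linear (fun a : B => value a x : R^o).
Proof.
by move=> k a b; rewrite -[value (k *: a + b)]/(value_lin (k *: a + b)) linearP.
Qed.

Definition evaluation_lin x : {linear B -> R^o} :=
  HB.pack (fun a : B => value a x : R^o)
    (GRing.isLinear.Build _ _ _ _ _ (@evaluation_linear x)).

Lemma evaluation_continuous x : continuous (evaluation_lin x).
Proof.
apply: bounded_linear_continuous; apply/linear_boundedP.
have [M phiM] := phi_summable x; have M0 : 0 <= M.
  by rewrite (le_trans _ (phiM fset0))// sumr_ge0.
exists M; split; first exact: ger0_real.
move=> C MC a /=; have e := @expands_value _ _ (ler_coef_norm a) x.
apply: partial_sum_le e => J; rewrite (le_trans (ler_norm_sum _ _ _))//.
rewrite (@le_trans _ _ (\sum_(i <- J) `|a| * `|phi i x|))//.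
  by apply: ler_sum => i _; rewrite normrM ler_wpM2r// ler_coef_norm.
by rewrite -mulr_sumr mulrC ler_wpM2r// (le_trans (phiM J))// ltW.
Qed.

Lemma evaluation_dual x : (evaluation_lin x : B -> R^o) \in @dual_pred R B.
Proof.
rewrite inE; split; [exact: evaluation_linear|exact: evaluation_continuous].
Qed.

Definition evaluation x : dual B := Dual (evaluation_dual x).

(** Once K(x, .) is identified with [evaluation x] and K(., y) with [phi_seq y], both pairing
    identities hold by computation: applying [evaluation x] to f is [value f x], and applying g to
    [phi_seq y] is [dual_value g y]. Injectivity of the two realizations reduces any representative
    to these. *)
Lemma expansion_space_two_sided (K : X -> X -> R) :
  (forall y, expands (phi^~ y) (K y)) -> two_sided_RKBS expansion_space K.
Proof.
move=> phiK.
(* The series is symmetric in its two points, so expanding [K x] and evaluating at y also expands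
   [K^~ y] at x. *)
have phiK' y : expands (phi^~ y) (K^~ y).
  move=> x; rewrite (_ : (fun _ => _) = fun i => phi i x * phi i y).
    exact: phiK.
  by apply/funext => i; rewrite mulrC.
have eval_phi x : value_lin (phi_seq x) = K^~ x.
  by apply/funext => y; apply: partial_sum_cvg_eq; exact: phiK'.
have phi_eval x : dual_value_lin (evaluation x) = K x.
  apply/funext => y.
  by rewrite -[LHS]/(value_lin (phi_seq y) x) eval_phi.
exists dual_expansion_space, (@dual_lin R B); split.
- exact: isometric_onto_dual_lin.
- split=> [x|x g gK f]; first by exists (evaluation x); exact: phi_eval.
  have -> : g = evaluation x by apply: dual_value_inj; rewrite phi_eval; exact: gK.
  by [].
- split=> [y|y f fK g]; first by exists (phi_seq y); exact: eval_phi.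
  have -> : f = phi_seq y by apply: value_inj; rewrite eval_phi; exact: fK.
  by [].
Qed.

Lemma coef_small_tails_bounded (a : I -> R) : small_tails N a ->
  forall i, `|a i| <= fsn_sup N a.
Proof. by move=> ta i; rewrite -(fsn_set1 N) le_fsn_sup. Qed.

Lemma expansion_space_range : range (bfs_fun expansion_space) =
  [set f | exists2 a, small_tails N a & expands a f].
Proof.
apply/seteqP; split=> [_ [a _ <-]|f [a ta af]].
  exists a; first exact: small_tails_coefs.
  exact: expands_value (ler_coef_norm a).
exists (SeqSpace (mem_set ta)) => //; apply/funext => x /=.
by apply: partial_sum_cvg_eq; exact: af.
Qed.

Lemma expansion_space_norm (f : expansion_space) (a : I -> R) :
  small_tails N a -> expands a (bfs_fun expansion_space f) ->
  `|f| = fsn_sup N a.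
Proof.
move=> ta af; rewrite [LHS](_ : _ = fsn_sup N (f : B))//; congr fsn_sup.
apply: (expands_uniq_coef (ler_coef_norm (f : B)) (coef_small_tails_bounded ta) _ af).
exact: expands_value (ler_coef_norm (f : B)).
Qed.

End expansion_space.

(** * The spaces l_p and c_0 *)

Section lp_norms.
Context {R : realType} {I : choiceType}.
Implicit Types (a b : I -> R) (J : {fset I}).

Lemma sum_fset_le_esum (u : I -> R) J : (forall i, 0 <= u i) ->
  ((\sum_(i <- J) u i)%:E <= \esum_(i in [set: I]) (u i)%:E)%E.
Proof.
move=> u0; apply: esum_ge; exists [set` J]; first by split.
by rewrite fsbig_finite//= set_fsetK sumEFin.
Qed.

Lemma esum_le (u : I -> R) M : (forall J, \sum_(i <- J) u i <= M) ->
  (\esum_(i in [set: I]) (u i)%:E <= M%:E)%E.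
Proof.
move=> uM; apply: ge_ereal_sup => _ [A [finA _] <-].
by rewrite fsbig_finite//= sumEFin lee_fin.
Qed.

Lemma fine_esum (u : I -> R) : (forall i, 0 <= u i) ->
  (\esum_(i in [set: I]) (u i)%:E < +oo)%E ->
  (forall J, \sum_(i <- J) u i <= fine (\esum_(i in [set: I]) (u i)%:E)) /\
  (forall M, (forall J, \sum_(i <- J) u i <= M) ->
    fine (\esum_(i in [set: I]) (u i)%:E) <= M).
Proof.
move=> u0 uoo; have fu : \esum_(i in [set: I]) (u i)%:E \is a fin_num.
  by rewrite ge0_fin_numE// esum_ge0// => i _; rewrite lee_fin.
split=> [J|M uM]; first by rewrite -lee_fin fineK// sum_fset_le_esum.
by rewrite -lee_fin fineK// esum_le.
Qed.

Section finite_exponent.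
Variables (r : R) (r1 : 1 <= r).

Let r0 : 0 < r. Proof. exact: lt_le_trans r1. Qed.
Let r_neq0 : r != 0. Proof. by rewrite gt_eqF. Qed.

Definition lr_fsn J a : R := (\sum_(i <- J) `|a i| `^ r) `^ r^-1.

Let sum_ge0 J a : 0 <= \sum_(i <- J) `|a i| `^ r.
Proof. by rewrite sumr_ge0// => i _; rewrite powR_ge0. Qed.

Let root_le x y : 0 <= x -> 0 <= y -> x <= y -> x `^ r^-1 <= y `^ r^-1.
Proof.
by move=> x0 y0; apply: ge0_ler_powR; rewrite ?nnegrE ?invr_ge0 ?(ltW r0).
Qed.

Lemma lr_fsn_ge0 J a : 0 <= lr_fsn J a.
Proof. exact: powR_ge0. Qed.

Lemma lr_fsn_powR J a : lr_fsn J a `^ r = \sum_(i <- J) `|a i| `^ r.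
Proof. by rewrite -powRrM mulVf// powRr1. Qed.

Lemma lr_fsn_le J a M : 0 <= M ->
  (lr_fsn J a <= M) = (\sum_(i <- J) `|a i| `^ r <= M `^ r).
Proof.
move=> M0; rewrite -lr_fsn_powR; apply/idP/idP => [aM|].
  by rewrite ge0_ler_powR ?nnegrE ?lr_fsn_ge0// (ltW r0).
move=> aM; have := root_le (powR_ge0 _ _) (powR_ge0 _ _) aM.
by rewrite /lr_fsn -!powRrM mulfV// mulr1 powRr1.
Qed.

Lemma powR_convex (s x y : R) : 0 <= s <= 1 -> 0 <= x -> 0 <= y ->
  (s * x + (1 - s) * y) `^ r <= s * x `^ r + (1 - s) * y `^ r.
Proof.
move=> /andP[s0 s1] x0 y0; have := @convex_powR _ _ r1 (Itv01 s0 s1) x y.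
by rewrite !convRE/=; apply; rewrite inE/= in_itv/= ?x0 ?y0.
Qed.

Lemma powR_div (x y : R) : 0 <= x -> 0 < y -> x `^ r / y `^ r = (x / y) `^ r.
Proof.
move=> x0 y0; have yV0 : 0 <= y^-1 by rewrite invr_ge0 ltW.
rewrite (powRM r x0 yV0); congr (_ * _).
have yr0 : 0 <= y `^ r by exact: powR_ge0.
by rewrite -(powR_inv1 yr0) -(powR_inv1 (ltW y0)) -!powRrM mulrC.
Qed.

(* Convexity of t |-> t ^ r makes the unit ball convex. *)
Lemma lr_fsn_triangle J a b : lr_fsn J (a + b) <= lr_fsn J a + lr_fsn J b.
Proof.
apply/ler_addgt0Pr => e e0.
(* The margin e / 2 makes both divisors positive even when a or b vanishes on J. *)
pose A := lr_fsn J a + e / 2; pose B := lr_fsn J b + e / 2.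
have A0 : 0 < A by rewrite /A ltr_wpDl ?lr_fsn_ge0 ?divr_gt0.
have B0 : 0 < B by rewrite /B ltr_wpDl ?lr_fsn_ge0 ?divr_gt0.
have -> : lr_fsn J a + lr_fsn J b + e = A + B by rewrite /A /B addrACA -splitr.
have lA : lr_fsn J a <= A by rewrite lerDl divr_ge0// ltW.
have lB : lr_fsn J b <= B by rewrite lerDl divr_ge0// ltW.
clearbody A B; have AB0 : 0 < A + B by exact: addr_gt0.
have aA : \sum_(i <- J) `|a i| `^ r <= A `^ r.
  by rewrite -lr_fsn_le// ltW.
have bB : \sum_(i <- J) `|b i| `^ r <= B `^ r.
  by rewrite -lr_fsn_le// ltW.
have Ar0 : 0 < A `^ r by rewrite powR_gt0.
have Br0 : 0 < B `^ r by rewrite powR_gt0.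
have ABr0 : 0 < (A + B) `^ r by rewrite powR_gt0.
rewrite (lr_fsn_le _ _ (ltW AB0)).
(* With this weight, (|a i| + |b i|) / (A + B) is the convex combination of |a i| / A and |b i| /
   B. *)
pose s := A / (A + B).
have s01 : 0 <= s <= 1.
  apply/andP; split; first by rewrite divr_ge0// ltW.
  by rewrite ler_pdivrMr// mul1r lerDl ltW.
have sB : 1 - s = B / (A + B) by rewrite /s; field; rewrite gt_eqF.
apply: (@le_trans _ _ (\sum_(i <- J) (A + B) `^ r *
    (s * (`|a i| `^ r / A `^ r) + (1 - s) * (`|b i| `^ r / B `^ r)))).
  apply: ler_sum => i _.
  rewrite !powR_div//.
  apply: (@le_trans _ _ ((A + B) `^ r *
      (s * (`|a i| / A) + (1 - s) * (`|b i| / B)) `^ r)).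
    have c0 : 0 <= s * (`|a i| / A) + (1 - s) * (`|b i| / B).
      by rewrite sB /s addr_ge0// mulr_ge0// divr_ge0// ltW.
    rewrite -(powRM _ (ltW AB0) c0) (_ : (A + B) * _ = `|a i| + `|b i|).
      by rewrite ge0_ler_powR ?nnegrE ?addr_ge0 ?(ltW r0)// ler_normD.
    by rewrite sB /s; field; rewrite !gt_eqF.
  by rewrite ler_wpM2l ?powR_ge0// powR_convex// divr_ge0// ltW.
rewrite -mulr_sumr big_split/= -!mulr_sumr -!mulr_suml.
rewrite ler_piMr ?powR_ge0//.
have : (\sum_(i <- J) `|a i| `^ r) / A `^ r <= 1 by rewrite ler_pdivrMr// mul1r.
have : (\sum_(i <- J) `|b i| `^ r) / B `^ r <= 1 by rewrite ler_pdivrMr// mul1r.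
move: s01 => /andP[s0 s1]; nra.
Qed.

Lemma lr_fsn_scale J c a : lr_fsn J (c *: a) = `|c| * lr_fsn J a.
Proof.
rewrite /lr_fsn (eq_bigr (fun i => `|c| `^ r * `|a i| `^ r)) => [|i _].
  rewrite -mulr_sumr powRM ?powR_ge0 ?sum_ge0//.
  by rewrite -powRrM mulfV// powRr1.
by rewrite normrM powRM.
Qed.

Lemma lr_fsn_restr J J' a : (J `<=` J')%fset ->
  lr_fsn J' (restr J a) = lr_fsn J a.
Proof.
move=> JJ'; rewrite /lr_fsn (sum_fset_subD _ JJ') addrC big_seq big1 ?add0r.
  congr (_ `^ _); rewrite big_seq [RHS]big_seq; apply: eq_bigr => i iJ.
  by rewrite /restr iJ.
by move=> i; rewrite inE /restr => /andP[/negbTE-> _]; rewrite normr0 powR0.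
Qed.

Lemma lr_fsn_mono J J' a : (J `<=` J')%fset -> lr_fsn J a <= lr_fsn J' a.
Proof.
move=> JJ'; rewrite lr_fsn_le ?lr_fsn_ge0// lr_fsn_powR (sum_fset_subD _ JJ').
by rewrite lerDl sum_ge0.
Qed.

Lemma lr_fsn_set1 i a : lr_fsn [fset i]%fset a = `|a i|.
Proof. by rewrite /lr_fsn big_seq_fset1 -powRrM mulfV// powRr1. Qed.

Definition lr_fset_norm : fset_norm :=
  FsetNorm lr_fsn_triangle lr_fsn_scale lr_fsn_restr lr_fsn_mono lr_fsn_set1.

Lemma lr_small_tailsP a : small_tails lr_fset_norm a <-> lp_family r%:E a.
Proof.
split=> [/small_tails_bounded[_ [M /ubP aM]]|au].
  apply: le_lt_trans (ltry (`|M| `^ r)); apply: esum_le => J.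
  rewrite -lr_fsn_le//; apply: le_trans (ler_norm M).
  by apply: aM; exists J.
have [aS _] := fine_esum (fun i => powR_ge0 `|a i| r) au.
have sa : abs_summable (fun i => `|a i| `^ r).
  exists (fine (\esum_(i in [set: I]) (`|a i| `^ r)%:E)) => J.
  by rewrite (eq_bigr (fun i => `|a i| `^ r))// => i _; rewrite ger0_norm ?powR_ge0.
(* The threshold is e ^ r because the seminorm takes an r-th root of the tail sum. *)
move=> e e0; have [J Je] := abs_summable_tail sa (powR_gt0 r e0).
exists J => K; rewrite [_ <= _](lr_fsn_le _ _ (ltW e0)); apply: le_trans (Je K).
by apply: ler_sum => i _; rewrite ler_norm.
Qed.

Lemma lr_norm a : lp_family r%:E a -> fsn_sup lr_fset_norm a = lp_norm r%:E a.
Proof.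
move=> au; have [aS aM] := fine_esum (fun i => powR_ge0 `|a i| r) au.
apply/eqP; rewrite eq_le; apply/andP; split.
  apply: fsn_sup_le => J; rewrite [_ <= _]lr_fsn_le ?powR_ge0//.
  rewrite -powRrM mulVf// powRr1 ?aS//.
  by rewrite (le_trans _ (aS fset0))// sum_ge0.
have ta := (lr_small_tailsP a).2 au.
have s0 : 0 <= fsn_sup lr_fset_norm a.
  by rewrite (le_trans (fsn_ge0 lr_fset_norm fset0 a))// le_fsn_sup.
have : fine (\esum_(i in [set: I]) (`|a i| `^ r)%:E) <= fsn_sup lr_fset_norm a `^ r.
  by apply: aM => J; rewrite -lr_fsn_le//; exact: (le_fsn_sup (N := lr_fset_norm)).
move=> h; have := root_le (le_trans (sum_ge0 fset0 a) (aS fset0)) (powR_ge0 _ _) h.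
by rewrite -powRrM mulfV// powRr1.
Qed.

End finite_exponent.
Section infinite_exponent.

Definition max_fsn J a : R := \big[Num.max/0]_(i <- J) `|a i|.

Lemma max_fsn_coord J a i : i \in J -> `|a i| <= max_fsn J a.
Proof.
by move=> iJ; exact: (le_bigmax_seq 0 i xpredT (fun i => `|a i|) iJ isT).
Qed.

Lemma max_fsn_leP J a M : 0 <= M ->
  (max_fsn J a <= M) <-> (forall i, i \in J -> `|a i| <= M).
Proof.
move=> M0; split=> [aM i iJ|aM]; first exact: le_trans (max_fsn_coord _ iJ) aM.
by rewrite /max_fsn big_seq; apply: bigmax_le.
Qed.

Lemma max_fsn_ge0 J a : 0 <= max_fsn J a.
Proof. exact: bigmax_ge_id. Qed.

Lemma max_fsn_triangle J a b : max_fsn J (a + b) <= max_fsn J a + max_fsn J b.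
Proof.
apply/max_fsn_leP => [|i iJ]; first by rewrite addr_ge0 ?max_fsn_ge0.
by rewrite (le_trans (ler_normD _ _))// lerD ?max_fsn_coord.
Qed.

Lemma max_fsn_scale J c a : max_fsn J (c *: a) = `|c| * max_fsn J a.
Proof.
rewrite /max_fsn; elim: (enum_fset J) => [|i s IH].
  by rewrite !big_nil mulr0.
by rewrite !big_cons maxr_pMr// -IH normrM.
Qed.

Lemma max_fsn_mono J J' a : (J `<=` J')%fset -> max_fsn J a <= max_fsn J' a.
Proof.
move=> JJ'; apply/max_fsn_leP => [|i iJ]; first exact: max_fsn_ge0.
by apply: max_fsn_coord; exact: (fsubsetP JJ').
Qed.

Lemma max_fsn_restr J J' a : (J `<=` J')%fset ->
  max_fsn J' (restr J a) = max_fsn J a.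
Proof.
move=> JJ'; apply/eqP; rewrite eq_le; apply/andP; split.
  apply/max_fsn_leP => [|i iJ]; first exact: max_fsn_ge0.
  rewrite /restr; case: ifPn => [|_]; first exact: max_fsn_coord.
  by rewrite normr0 max_fsn_ge0.
apply/max_fsn_leP => [|i iJ]; first exact: max_fsn_ge0.
have := @max_fsn_coord J' (restr J a) i ((fsubsetP JJ') _ iJ).
by rewrite /restr iJ.
Qed.

Lemma max_fsn_set1 i a : max_fsn [fset i]%fset a = `|a i|.
Proof.
apply/eqP; rewrite eq_le; apply/andP; split.
  by apply/max_fsn_leP => // j; rewrite inE => /eqP ->.
by apply: max_fsn_coord; rewrite inE.
Qed.

Definition max_fset_norm : fset_norm :=
  FsetNorm max_fsn_triangle max_fsn_scale max_fsn_restr max_fsn_mono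
    max_fsn_set1.

Lemma max_small_tailsP a : small_tails max_fset_norm a <-> lp_family +oo%E a.
Proof.
split=> [ta e e0|fa e e0].
  (* Half of e is needed for a strict contradiction: for i outside J the singleton of i is a tail,
     giving |a i| <= e / 2 < e. *)
  have e20 : 0 < e / 2 by rewrite divr_gt0.
  have [J Je] := ta _ e20.
  apply: (@sub_finite_set _ _ [set` J]) => // i /= ai.
  apply: contraT => iJ; have := Je [fset i]%fset.
  have /max_fsn_coord/le_trans h : i \in ([fset i] `\` J)%fset by rewrite !inE iJ/=.
  by move=> /h /(le_trans ai); rewrite leNgt ltr_pdivrMr// ltr_pMr// ltr1n.
have [J JE] := (finite_fsetP).1 (fa e e0).
exists J => K; apply/max_fsn_leP => [|i]; first exact: ltW.
rewrite !inE => /andP[iJ _]; rewrite leNgt; apply: contra iJ => /ltW eai.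
have : [set i | e <= `|a i|] i by [].
by rewrite JE.
Qed.

Lemma max_norm (i0 : I) a : lp_family +oo%E a ->
  fsn_sup max_fset_norm a = lp_norm +oo%E a.
Proof.
move=> /max_small_tailsP ta.
have ha : has_sup (range (fun i => `|a i|)).
  split; first by exists `|a i0|, i0.
  exists (fsn_sup max_fset_norm a) => _ [i _ <-].
  by rewrite -(fsn_set1 max_fset_norm) le_fsn_sup.
have a_le i : `|a i| <= sup (range (fun i => `|a i|)).
  by apply: (sup_upper_bound ha); exists i.
apply/eqP; rewrite eq_le; apply/andP; split.
  apply: fsn_sup_le => J; apply/max_fsn_leP => // .
  exact: le_trans (a_le i0).
apply: ge_sup; first by exists `|a i0|, i0.
by move=> _ [i _ <-]; rewrite -(fsn_set1 max_fset_norm) le_fsn_sup.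
Qed.

End infinite_exponent.

Lemma lp_fset_norm (i0 : I) (p : \bar R) : (1 <= p)%E ->
  exists N : @fset_norm R I, forall a,
    (small_tails N a <-> lp_family p a) /\
    (lp_family p a -> fsn_sup N a = lp_norm p a).
Proof.
case: p => [r|_|//].
  rewrite lee_fin => r1; exists (lr_fset_norm r1) => a.
  by split; [exact: lr_small_tailsP|exact: lr_norm].
exists max_fset_norm => a.
by split; [exact: max_small_tailsP|exact: max_norm].
Qed.

End lp_norms.

(** * The quartic cosine series *)

Section derivatives.
Context {R : realType}.
Implicit Types (x t k : R).

Lemma is_derive_cosM k x : is_derive x 1 (fun t => cos (k * t)) (- k * sin (k * x)).
Proof.
have h : is_derive x 1 (fun t => k * t) k.
  apply: (is_derive_eq (is_deriveZ k (is_derive_id x 1))).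
  by rewrite /GRing.scale/= mulr1.
have := @is_derive1_comp R cos (fun t => k * t) x _ _ (is_derive_cos (k * x)) h.
by move/is_derive_eq; apply; rewrite mulrC mulrN mulNr.
Qed.

Lemma is_derive_sinM k x : is_derive x 1 (fun t => sin (k * t)) (k * cos (k * x)).
Proof.
have h : is_derive x 1 (fun t => k * t) k.
  apply: (is_derive_eq (is_deriveZ k (is_derive_id x 1))).
  by rewrite /GRing.scale/= mulr1.
have := @is_derive1_comp R sin (fun t => k * t) x _ _ (is_derive_sin (k * x)) h.
by move/is_derive_eq; apply; rewrite mulrC.
Qed.

Lemma is_deriveMr (c : R) (f : R -> R) df x : is_derive x 1 f df ->
  is_derive x 1 (fun t => f t * c) (df * c).
Proof.
move=> fdf; rewrite (_ : (fun _ => _) = (fun t => c * f t)); last first.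
  by apply/funext => t; rewrite mulrC.
by apply: (is_derive_eq (is_deriveZ c fdf)); rewrite mulrC.
Qed.

Lemma is_derive_subX (c x : R) n :
  is_derive x 1 (fun t => (t - c) ^+ n) (n%:R * (x - c) ^+ n.-1).
Proof.
have h : is_derive x 1 (fun t => t - c) 1.
  apply: (is_derive_eq (is_deriveB (is_derive_id x 1) (is_derive_cst c x 1))).
  by rewrite subr0.
rewrite (_ : (fun _ => _) = (fun t => t - c) ^+ n); last by rewrite exprfctE.
by apply: (is_derive_eq (is_deriveX n h)); rewrite /GRing.scale/= mulr1.
Qed.

Lemma is_derive_bigsum n (f df : nat -> R -> R) x :
  (forall i, is_derive x 1 (f i) (df i x)) ->
  is_derive x 1 (fun t => \sum_(i < n) f i t) (\sum_(i < n) df i x).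
Proof.
move=> fdf; elim: n => [|n IH].
  rewrite big_ord0 (_ : (fun _ => _) = cst 0); first exact: is_derive_cst.
  by apply/funext => t; rewrite big_ord0.
rewrite big_ord_recr/= (_ : (fun _ => _) =
  (fun t => \sum_(i < n) f i t) + f n); first exact: is_deriveD.
by apply/funext => t; rewrite big_ord_recr.
Qed.

Lemma mvt_bound (f df : R -> R) (a b M : R) : a <= b ->
  (forall x, a <= x <= b -> is_derive x 1 f (df x)) ->
  (forall x, a <= x <= b -> `|df x| <= M) -> `|f b - f a| <= M * (b - a).
Proof.
move=> ab fdf dfM.
have [c /[!in_itv]/= cab ->] : exists2 c, c \in `[a, b]%R & f b - f a = df c * (b - a).
  apply: MVT_segment => // [x /[!in_itv]/= /andP[/ltW ax /ltW xb]|].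
    by apply: fdf; rewrite ax xb.
  apply: derivable_within_continuous => x /[!in_itv]/= xab.
  by have := fdf x xab; case.
by rewrite normrM (ger0_norm (_ : 0 <= b - a)) ?subr_ge0// ler_wpM2r ?subr_ge0// dfM.
Qed.

Lemma dirichlet_kernel N t :
  2 * sin (t / 2) * (2^-1 + \sum_(n < N) cos (n.+1%:R * t)) =
  sin ((N%:R + 2^-1) * t).
Proof.
elim: N => [|N IH].
  by rewrite big_ord0 addr0 add0r mulrAC mulfV// mul1r mulrC.
rewrite big_ord_recr/= addrA mulrDr IH.
have -> : (N.+1%:R + 2^-1) * t = N.+1%:R * t + t / 2 by rewrite mulrDl mulrC [t / 2]mulrC.
have -> : (N%:R + 2^-1) * t = N.+1%:R * t - t / 2 by rewrite -natr1; field.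
rewrite sinB sinD; ring.
Qed.

End derivatives.

Section quartic_cosine_series.
Context {R : realType}.
Implicit Types (x t : R).

Definition cos_sum (N : nat) t : R := \sum_(n < N) cos (n.+1%:R * t) / n.+1%:R ^+ 4.

(** This is - (2 pi)^4 / 48 times the Bernoulli polynomial B_4 at t / (2 pi), written in powers of t
    - pi because the integrations start at pi. *)
Definition quartic t : R :=
  - 48^-1 * (t - pi) ^+ 4 + pi ^+ 2 / 24 * (t - pi) ^+ 2 - 7 * pi ^+ 4 / 720.

Lemma quartic_sym t : quartic (pi *+ 2 - t) = quartic t.
Proof. by rewrite /quartic; field. Qed.

Lemma cos_natpi_sub m t : cos (m%:R * pi - t) = (-1) ^+ m * cos t.
Proof.
by rewrite addrC mulr_natl (alternatingn (@cosDpi R)) cosN.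
Qed.

Lemma cos_sum_sym N t : cos_sum N (pi *+ 2 - t) = cos_sum N t.
Proof.
apply: eq_bigr => n _; congr (_ / _).
rewrite mulrBr -(mulr_natl pi) mulrA -natrM cos_natpi_sub.
by rewrite muln2 -signr_odd odd_double expr0 mul1r.
Qed.

Lemma quartic_duplication t : quartic (t / 2) + quartic (pi - t / 2) = quartic t / 8.
Proof. by rewrite /quartic; field. Qed.

(** cos (n t / 2) and cos (n (pi - t / 2)) cancel for odd n and agree for even n. The term n = 2 k
    contributes 2 cos (k t) / (16 k^4), whence the factor 1/8 and the doubled number of terms. *)
Lemma cos_sum_duplication N t :
  cos_sum N.*2 (t / 2) + cos_sum N.*2 (pi - t / 2) = cos_sum N t / 8.
Proof.
rewrite /cos_sum -big_split/=.
elim: N => [|N IH]; first by rewrite !big_ord0 mul0r.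
rewrite doubleS !big_ord_recr/= IH [RHS]mulrDl -addrA; congr (_ + _).
have sodd : (-1) ^+ N.*2.+1 = -1 :> R by rewrite exprS -signr_odd odd_double mulr1.
have seven : (-1) ^+ N.*2.+2 = 1 :> R by rewrite exprS sodd mulrNN mulr1.
rewrite !mulrBr !cos_natpi_sub sodd seven mulN1r mul1r mulNr subrr add0r.
have -> : N.*2.+2%:R = 2 * N.+1%:R :> R by rewrite -doubleS -mul2n natrM.
have -> : 2 * N.+1%:R * (t / 2) = N.+1%:R * t :> R by field.
by field; rewrite nat1r pnatr_eq0.
Qed.

Definition err N t : R := cos_sum N t - quartic t.

(** [err1], [err2] and [err3] are the successive derivatives of [err]. The derivative of [err3] is
    the Dirichlet kernel, its 1/2 coming from the leading coefficient - 1/48 of [quartic]. *)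
Definition err1 N t : R := \sum_(n < N) - (sin (n.+1%:R * t) / n.+1%:R ^+ 3) -
  (- 12^-1 * (t - pi) ^+ 3 + pi ^+ 2 / 12 * (t - pi)).

Definition err2 N t : R := \sum_(n < N) - (cos (n.+1%:R * t) / n.+1%:R ^+ 2) -
  (- 4^-1 * (t - pi) ^+ 2 + pi ^+ 2 / 12).

Definition err3 N t : R := \sum_(n < N) sin (n.+1%:R * t) / n.+1%:R +
  2^-1 * (t - pi).

Lemma is_derive_err N t : is_derive t 1 (err N) (err1 N t).
Proof.
have dX := is_derive_subX pi t.
have dS : is_derive t 1 (cos_sum N) (\sum_(n < N) - (sin (n.+1%:R * t) / n.+1%:R ^+ 3)).
  apply: (@is_derive_bigsum R N (fun n t => cos (n.+1%:R * t) / n.+1%:R ^+ 4)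
    (fun n t => - (sin (n.+1%:R * t) / n.+1%:R ^+ 3))) => n.
  apply: (is_derive_eq (is_deriveMr _ (is_derive_cosM _ _))).
  by field; rewrite nat1r pnatr_eq0.
have dq : is_derive t 1 quartic (- 12^-1 * (t - pi) ^+ 3 + pi ^+ 2 / 12 * (t - pi)).
  have := is_deriveB (is_deriveD (is_deriveZ (- 48^-1) (dX 4))
      (is_deriveZ (pi ^+ 2 / 24) (dX 2)))
    (is_derive_cst (7 * pi ^+ 4 / 720) t 1).
  by move/is_derive_eq; apply; rewrite /GRing.scale/=; field.
exact: (is_deriveB dS dq).
Qed.

Lemma is_derive_err1 N t : is_derive t 1 (err1 N) (err2 N t).
Proof.
have dX := is_derive_subX pi t.
have dS : is_derive t 1 (fun t => \sum_(n < N) - (sin (n.+1%:R * t) / n.+1%:R ^+ 3))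
    (\sum_(n < N) - (cos (n.+1%:R * t) / n.+1%:R ^+ 2)).
  apply: (@is_derive_bigsum R N (fun n t => - (sin (n.+1%:R * t) / n.+1%:R ^+ 3))
    (fun n t => - (cos (n.+1%:R * t) / n.+1%:R ^+ 2))) => n.
  apply: (is_derive_eq (is_deriveN (is_deriveMr _ (is_derive_sinM _ _)))).
  by field; rewrite nat1r pnatr_eq0.
have dq : is_derive t 1 (fun t => - 12^-1 * (t - pi) ^+ 3 + pi ^+ 2 / 12 * (t - pi))
    (- 4^-1 * (t - pi) ^+ 2 + pi ^+ 2 / 12).
  have := is_deriveD (is_deriveZ (- 12^-1) (dX 3)) (is_deriveZ (pi ^+ 2 / 12) (dX 1)).
  by move/is_derive_eq; apply; rewrite /GRing.scale/=; field.
exact: (is_deriveB dS dq).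
Qed.

Lemma is_derive_err2 N t : is_derive t 1 (err2 N) (err3 N t).
Proof.
have dX := is_derive_subX pi t.
have dS : is_derive t 1 (fun t => \sum_(n < N) - (cos (n.+1%:R * t) / n.+1%:R ^+ 2))
    (\sum_(n < N) sin (n.+1%:R * t) / n.+1%:R).
  apply: (@is_derive_bigsum R N (fun n t => - (cos (n.+1%:R * t) / n.+1%:R ^+ 2))
    (fun n t => sin (n.+1%:R * t) / n.+1%:R)) => n.
  apply: (is_derive_eq (is_deriveN (is_deriveMr _ (is_derive_cosM _ _)))).
  by field; rewrite nat1r pnatr_eq0.
have dq : is_derive t 1 (fun t => - 4^-1 * (t - pi) ^+ 2 + pi ^+ 2 / 12)
    (- 2^-1 * (t - pi)).
  have := is_deriveD (is_deriveZ (- 4^-1) (dX 2)) (is_derive_cst (pi ^+ 2 / 12) t 1).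
  by move/is_derive_eq; apply; rewrite /GRing.scale/=; field.
have := is_deriveB dS dq.
by move/is_derive_eq; apply; rewrite /err3; ring.
Qed.

Lemma is_derive_err3 N t : is_derive t 1 (err3 N)
  (2^-1 + \sum_(n < N) cos (n.+1%:R * t)).
Proof.
have dX := is_derive_subX pi t.
have dS : is_derive t 1 (fun t => \sum_(n < N) sin (n.+1%:R * t) / n.+1%:R)
    (\sum_(n < N) cos (n.+1%:R * t)).
  apply: (@is_derive_bigsum R N (fun n t => sin (n.+1%:R * t) / n.+1%:R)
    (fun n t => cos (n.+1%:R * t))) => n.
  apply: (is_derive_eq (is_deriveMr _ (is_derive_sinM _ _))).
  by field; rewrite nat1r pnatr_eq0.
have := is_deriveD dS (is_deriveZ 2^-1 (dX 1)).
by move/is_derive_eq; apply; rewrite /GRing.scale/=; ring.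
Qed.

Lemma sin_natpi m : sin (m%:R * pi) = 0 :> R.
Proof. by rewrite mulr_natl -[pi *+ m]add0r (alternatingn (@sinDpi R)) sin0 mulr0. Qed.

Lemma err3_pi N : err3 N pi = 0 :> R.
Proof.
by rewrite /err3 subrr mulr0 addr0 big1// => n _; rewrite sin_natpi mul0r.
Qed.

Lemma err1_pi N : err1 N pi = 0 :> R.
Proof.
rewrite /err1 subrr expr0n/= !mulr0 addr0 subr0 big1// => n _.
by rewrite sin_natpi mul0r oppr0.
Qed.

(* Abel summation in continuous form: adding cos ((N + 1/2) t) w t / (N + 1/2)
   cancels the Dirichlet kernel in the derivative of err3. *)
Lemma err3_bound (d : R) : 0 < d -> exists C, forall N t, d <= t <= pi ->
  `|err3 N t| <= C / (N%:R + 2^-1).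
Proof.
move=> d0; pose s := sin (2^-1 * d); pose W := (2 * s)^-1.
(* W ^ 2 pi accounts for the variation of [B] on [t, pi], and 2 W for the added term at the two
   endpoints. W bounds [w] there because sin (x / 2) increases on [d, pi]. *)
exists (W ^+ 2 * pi + 2 * W) => N t /andP[dt tpi].
have dpi := le_trans dt tpi.
have s0 : 0 < s by apply: sin_gt0_pi; lra.
have W0 : 0 < W by rewrite invr_gt0 mulr_gt0.
pose k : R := N%:R + 2^-1; have k0 : 0 < k by rewrite ltr_wpDl.
have kV : `|k^-1| = k^-1 by rewrite gtr0_norm ?invr_gt0.
pose w x : R := (2 * sin (2^-1 * x))^-1.
have sx x : t <= x <= pi -> s <= sin (2^-1 * x).
  move=> /andP[tx xpi]; have p0 := pi_gt0 R.
  have [<-|xd] := eqVneq d x; first exact: lexx.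
  have dx : d < x by rewrite lt_neqAle xd (le_trans dt tx).
  by rewrite ltW// ltr_sin ?in_itv/=; lra.
have w_bound x : t <= x <= pi -> `|w x| <= W.
  move=> /sx sxx; have sx0 := lt_le_trans s0 sxx.
  rewrite ger0_norm ?invr_ge0 ?mulr_ge0 ?(ltW sx0)//.
  by rewrite lef_pV2 ?posrE ?mulr_gt0// ler_pM2l.
pose B x := err3 N x + cos (k * x) * w x / k.
pose dB x := - (cos (k * x) * cos (2^-1 * x) * w x ^+ 2 / k).
have B_derive x : t <= x <= pi -> is_derive x 1 B (dB x).
  move=> /sx sxx; have sx0 := lt_le_trans s0 sxx.
  have dw : is_derive x 1 w (- cos (2^-1 * x) * w x ^+ 2).
    have h : 2 * sin (2^-1 * x) != 0 by rewrite mulf_neq0 ?gt_eqF.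
    have := @is_deriveV R (fun x => 2 * sin (2^-1 * x)) x _ 1 h
      (is_deriveZ 2 (is_derive_sinM 2^-1 x)).
    move/is_derive_eq; apply.
    by rewrite /w /GRing.scale/=; field; rewrite gt_eqF.
  have := is_deriveD (is_derive_err3 N x)
    (is_deriveMr k^-1 (is_deriveM (is_derive_cosM k x) dw)).
  move=> /is_derive_eq; apply; rewrite /GRing.scale/=.
  have := dirichlet_kernel N x; rewrite -/k (mulrC x) => <-.
  rewrite /dB /w; field; rewrite !gt_eqF//.
have ttpi : t <= t <= pi by apply/andP; split.
have tpipi : t <= pi <= (pi : R) by apply/andP; split.
have rest x : t <= x <= pi -> `|cos (k * x) * w x / k| <= W / k.
  move=> /w_bound wx; rewrite !normrM kV.
  by rewrite ler_wpM2r ?invr_ge0 ?(ltW k0)// -[W]mul1r ler_pM// cos_max.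
have := @mvt_bound R B dB t pi (W ^+ 2 / k) tpi B_derive.
have dB_bound x : t <= x <= pi -> `|dB x| <= W ^+ 2 / k.
  move=> xx; have wx := w_bound x xx; rewrite normrN !normrM kV.
  rewrite ler_wpM2r ?invr_ge0 ?(ltW k0)// -[W ^+ 2]mul1r ler_pM ?mulr_ge0//.
    by rewrite -[1]mul1r ler_pM// cos_max.
  by rewrite expr2 ler_pM.
move=> /(_ dB_bound).
rewrite {1}/B err3_pi add0r /B => BB.
have := rest _ ttpi; have := rest _ tpipi.
rewrite ler_norml => /andP[h1 h2]; rewrite ler_norml => /andP[h3 h4].
move: BB; rewrite ler_norml => /andP[h5 h6].
have : W ^+ 2 / k * (pi - t) <= W ^+ 2 * pi / k.
  rewrite mulrAC ler_wpM2r ?invr_ge0 ?(ltW k0)// ler_wpM2l ?exprn_ge0 ?(ltW W0)//.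
  lra.
move=> h7; rewrite mulrDl -/k ler_norml (_ : 2 * W / k = W / k + W / k); last by ring.
by apply/andP; split; lra.
Qed.

(* Three integrations of err3_bound from pi, where err1 vanishes. *)
Lemma err_bound (d : R) : 0 < d -> exists C, forall N t, d <= t <= pi ->
  `|err N t - err N pi - err2 N pi / 2 * (t - pi) ^+ 2| <= C / (N%:R + 2^-1).
Proof.
move=> d0; have [C0 err3C] := err3_bound d0.
(* [err3_bound] leaves the sign of its constant open, hence the absolute value; each of the three
   integrations runs over a length at most pi and costs a factor pi. *)
pose C := `|C0|; exists (C * pi ^+ 3) => N t0 t0pi.
pose k : R := N%:R + 2^-1; have k0 : 0 < k by rewrite ltr_wpDl.
have Ck0 : 0 <= C / k by rewrite divr_ge0 ?normr_ge0// ltW.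
have e3 t : d <= t <= pi -> `|err3 N t| <= C / k.
  move=> /err3C/le_trans; apply.
  by rewrite ler_wpM2r ?invr_ge0 ?(ltW k0)// ler_norm.
have mvt (f df : R -> R) M t : 0 <= M -> d <= t <= pi ->
    (forall x, d <= x <= pi -> is_derive x 1 f (df x)) ->
    (forall x, d <= x <= pi -> `|df x| <= M) -> `|f t - f pi| <= M * pi.
  move=> M0 /andP[dt tpi] fdf dfM; rewrite distrC.
  have sub x : t <= x <= pi -> d <= x <= pi.
    by move=> /andP[tx ->]; rewrite (le_trans dt tx).
  apply: (@le_trans _ _ (M * (pi - t))).
    by apply: mvt_bound => // x /sub; [exact: fdf|exact: dfM].
  by rewrite ler_wpM2l//; lra.
have e2 t : d <= t <= pi -> `|err2 N t - err2 N pi| <= C / k * pi.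
  move=> dt; exact: (mvt (err2 N) (err3 N) (C / k) t Ck0 dt
    (fun x _ => is_derive_err2 N x) e3).
pose g1 t := err1 N t - err2 N pi * (t - pi).
have dg1 t : is_derive t 1 g1 (err2 N t - err2 N pi).
  have := is_deriveB (is_derive_err1 N t)
    (is_deriveZ (err2 N pi) (is_derive_subX pi t 1)).
  by move=> /is_derive_eq; apply; rewrite /GRing.scale/=; ring.
have Cpi0 : 0 <= C / k * pi by rewrite mulr_ge0// pi_ge0.
have e1 t : d <= t <= pi -> `|g1 t| <= C / k * pi * pi.
  move=> dt; have := mvt g1 _ _ t Cpi0 dt (fun x _ => dg1 x) e2.
  by rewrite {2}/g1 subrr mulr0 err1_pi !subr0.
pose g t := err N t - err2 N pi / 2 * (t - pi) ^+ 2.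
have dg t : is_derive t 1 g (g1 t).
  have := is_deriveB (is_derive_err N t)
    (is_deriveZ (err2 N pi / 2) (is_derive_subX pi t 2)).
  by move=> /is_derive_eq; apply; rewrite /GRing.scale/= /g1; field.
have Cpi20 : 0 <= C / k * pi * pi by rewrite mulr_ge0// pi_ge0.
have := mvt g _ _ t0 Cpi20 t0pi (fun x _ => dg x) e1.
rewrite /g subrr expr0n/= mulr0 subr0.
have -> : C * pi ^+ 3 / (N%:R + 2^-1) = C / k * pi * pi * pi.
  by rewrite -/k exprS expr2; ring.
by rewrite addrAC.
Qed.

Lemma sum_invsq_le N : \sum_(n < N) (n.+1%:R ^+ 2)^-1 <= 2 :> R.
Proof.
(* Strengthened for the induction, which uses 1/(M+2)^2 <= 1/(M+1) - 1/(M+2). *)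
suff h M : \sum_(n < M.+1) (n.+1%:R ^+ 2)^-1 <= 2 - M.+1%:R^-1 :> R.
  case: N => [|N]; first by rewrite big_ord0.
  by rewrite (le_trans (h N))// gerBl invr_ge0.
elim: M => [|M IH]; first by rewrite big_ord_recr big_ord0/= add0r expr1n invr1; lra.
rewrite big_ord_recr/= (le_trans (lerD IH (lexx _)))//.
have a0 : 0 < M.+1%:R :> R by rewrite ltr0n.
have -> : M.+2%:R = M.+1%:R + 1 :> R by rewrite -natr1.
move: (M.+1%:R : R) a0 => a a0.
rewrite -subr_ge0 (_ : _ - _ = (a * (a + 1) ^+ 2)^-1); last first.
  by field; rewrite !gt_eqF// addr_gt0.
by rewrite ltW// invr_gt0 mulr_gt0// exprn_gt0// addr_gt0.
Qed.

Lemma cvg_sum_invsq (u : nat -> R) : (forall n, `|u n| <= (n.+1%:R ^+ 2)^-1) ->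
  cvgn (fun N => \sum_(n < N) u n).
Proof.
move=> uv; have -> : (fun N => \sum_(n < N) u n) = series u.
  by apply/funext => N; rewrite /series/= big_mkord.
apply: normed_cvg; apply: nondecreasing_is_cvgn.
  by apply: (@nondecreasing_series _ (fun n => `|u n|) xpredT) => n _ _; exact: normr_ge0.
exists 2 => _ [N _ <-]; apply: le_trans (sum_invsq_le N).
change (\sum_(0 <= n < N) `|u n| <= \sum_(n < N) (n.+1%:R ^+ 2)^-1).
by rewrite big_mkord; apply: ler_sum => n _; exact: uv.
Qed.

Lemma cvg_cos_sum t : cvgn (cos_sum ^~ t).
Proof.
apply: (@cvg_sum_invsq (fun n => cos (n.+1%:R * t) / n.+1%:R ^+ 4)) => n.
rewrite normrM (le_trans (ler_pM _ _ (cos_max _) (lexx _)))//.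
rewrite mul1r ger0_norm ?invr_ge0 ?exprn_ge0// lef_pV2 ?posrE ?exprn_gt0//.
by rewrite ler_weXn2l// ler1n.
Qed.

Lemma cvg_err2 t : cvgn (err2 ^~ t).
Proof.
apply: is_cvgB; last exact: is_cvg_cst.
apply: (@cvg_sum_invsq (fun n => - (cos (n.+1%:R * t) / n.+1%:R ^+ 2))) => n.
rewrite normrN normrM (le_trans (ler_pM _ _ (cos_max _) (lexx _)))//.
by rewrite mul1r ger0_norm ?invr_ge0 ?exprn_ge0.
Qed.

Lemma cvg_half_inv : (N%:R + 2^-1 : R)^-1 @[N --> \oo] --> 0.
Proof.
have h0 : 2 * harmonic N @[N --> \oo] --> (0 : R).
  by rewrite -(mulr0 2); apply: cvgMl_tmp; exact: cvg_harmonic.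
apply: (squeeze_cvgr _ (cvg_cst 0) h0); apply: nearW => N.
have N0 : 0 <= N%:R :> R by [].
rewrite invr_ge0 addr_ge0//= /harmonic.
have -> : N.+1%:R = N%:R + 1 :> R by rewrite natr1.
rewrite -[leRHS]invrK invfM invrK lef_pV2 ?posrE ?mulr_gt0 ?invr_gt0//.
lra.
Qed.

(* The limit E of err is a + g (t - pi) ^ 2 / 2 on ]0, pi]; the duplication
   formula then forces a = g = 0, and extends E = 0 to t = 0. *)
Lemma cvg_cos_sum_quartic t : 0 <= t <= pi *+ 2 -> cos_sum N t @[N --> \oo] --> quartic t.
Proof.
pose L t := limn (cos_sum ^~ t); pose E t := L t - quartic t.
have cL s : cos_sum N s @[N --> \oo] --> L s by exact: cvg_cos_sum.
have cE s : err N s @[N --> \oo] --> E s.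
  by apply: cvgB; [exact: cL|exact: cvg_cst].
pose g : R := limn (err2 ^~ (pi : R)).
have cg : err2 N pi @[N --> \oo] --> g by exact: cvg_err2.
have Epi s : 0 < s <= pi -> E s = E pi + g / 2 * (s - pi) ^+ 2.
  move=> /andP[s0 spi]; have [C bnd] := err_bound s0.
  have c0 : C / (N%:R + 2^-1) @[N --> \oo] --> 0.
    by rewrite -(mulr0 C); apply: cvgMl_tmp; exact: cvg_half_inv.
  have c1 : `|err N s - err N pi - err2 N pi / 2 * (s - pi) ^+ 2| @[N --> \oo] -->
     `|E s - E pi - g / 2 * (s - pi) ^+ 2|.
    apply: cvg_norm; apply: cvgB; first by apply: cvgB; exact: cE.
    by do 2 apply: cvgMr_tmp; exact: cg.
  have := ler_cvg_to c1 c0; rewrite normr_le0 => h.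
  apply/eqP; rewrite -subr_eq0 opprD addrA; apply: h.
  by apply: nearW => N; apply: bnd; rewrite lexx spi.
have dup s : E (s / 2) + E (pi - s / 2) = E s / 8.
  rewrite /E addrACA -opprD quartic_duplication [RHS]mulrBl; congr (_ - _).
  have cL2 r : cos_sum N.*2 r @[N --> \oo] --> L r.
    have dbl : N.*2 @[N --> \oo] --> \oo.
      apply/cvgnyPge => A; exists A => // N /= AN.
      by rewrite -addnn (leq_trans AN)// leq_addr.
    exact: cvg_comp dbl (cL r).
  have h : cos_sum N s / 8 @[N --> \oo] --> L (s / 2) + L (pi - s / 2).
    under eq_fun do rewrite -cos_sum_duplication.
    by apply: cvgD; exact: cL2.
  by apply: (cvg_unique _ h) => //; apply: cvgMr_tmp; exact: cL.
have p0 := pi_gt0 R.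
have E0 s : 0 <= s <= pi -> E s = 0.
  (* With a = E pi and G = (g / 2) pi ^ 2, duplication at pi gives 15/8 a + G/2 = 0 and at 2 pi / 3
     gives 15/8 a + 13/24 G = 0, so a = G = 0. Duplication at 0 then gives 7/8 E 0 = - a = 0. *)
  have := dup 0; have := dup pi; have := dup (2 * pi / 3).
  rewrite (Epi (pi / 2) ltac:(lra)) (Epi (pi - pi / 2) ltac:(lra)).
  rewrite (Epi (2 * pi / 3 / 2) ltac:(lra)) (Epi (pi - 2 * pi / 3 / 2) ltac:(lra)).
  rewrite (Epi (2 * pi / 3) ltac:(lra)) mul0r subr0.
  have -> : g / 2 * (pi / 2 - pi) ^+ 2 = g / 2 * pi ^+ 2 / 4 by field.
  have -> : g / 2 * (pi - pi / 2 - pi) ^+ 2 = g / 2 * pi ^+ 2 / 4 by field.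
  have -> : g / 2 * (2 * pi / 3 / 2 - pi) ^+ 2 = g / 2 * pi ^+ 2 * 4 / 9 by field.
  have -> : g / 2 * (pi - 2 * pi / 3 / 2 - pi) ^+ 2 = g / 2 * pi ^+ 2 / 9 by field.
  have -> : g / 2 * (2 * pi / 3 - pi) ^+ 2 = g / 2 * pi ^+ 2 / 9 by field.
  move=> h1 h2 h3 /andP[]; rewrite le_eqVlt => /predU1P[<- _|s0 spi].
    by clearbody E; move: h1 h2 h3; move: (g / 2 * pi ^+ 2) (E pi) (E 0) => *; lra.
  have G0 : g / 2 * pi ^+ 2 = 0.
    by clearbody E; move: h1 h2 h3; move: (g / 2 * pi ^+ 2) (E pi) (E 0) => *; lra.
  have a0 : E pi = 0.
    by clearbody E; move: h1 h2 h3; move: (g / 2 * pi ^+ 2) (E pi) (E 0) => *; lra.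
  have g0 : g / 2 = 0.
    by apply/eqP; move/eqP: G0; rewrite mulf_eq0 expf_eq0/= (gt_eqF p0) orbF.
  by rewrite Epi ?s0// g0 mul0r addr0.
have E0' s : 0 <= s <= pi *+ 2 -> E s = 0.
  move=> /andP[s0 s2]; have [spi|spi] := leP s pi; first by rewrite E0// s0 spi.
  rewrite -(E0 (pi *+ 2 - s)); last by rewrite mulr2n in s2 *; lra.
  have -> : E (pi *+ 2 - s) = L (pi *+ 2 - s) - quartic s by rewrite /E quartic_sym.
  rewrite /E; congr (_ - _); apply: (cvg_unique _ (cL s)) => //.
  rewrite (_ : cos_sum ^~ s = cos_sum ^~ (pi *+ 2 - s)); first exact: cL.
  by apply/funext => N; rewrite cos_sum_sym.
by move=> /E0'/eqP; rewrite subr_eq0 => /eqP <-; exact: cL.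
Qed.

End quartic_cosine_series.

(** * The one-dimensional sine family *)

Section sine_family.
Context {R : realType}.
Implicit Types (x y t : R).

Definition phi1 (n : nat) x : R :=
  (n.+1%:R ^+ 2 * pi ^+ 2)^-1 * (Num.sqrt 2 * sin (n.+1%:R * pi * x)).

(** Closed form of the sum of phi1_n(x) phi1_n(y), read off from 2 sin a sin b = cos (a - b) - cos
    (a + b). The absolute value keeps the first argument in [0, 2 pi], where [quartic] represents
    the cosine series. *)
Definition K1 x y : R :=
  (quartic (pi * `|x - y|) - quartic (pi * (x + y))) / pi ^+ 4.

Lemma sinM2 (a b : R) : 2 * (sin a * sin b) = cos (a - b) - cos (a + b).
Proof. by rewrite cosB cosD; ring. Qed.

Lemma phi1M n x y : phi1 n x * phi1 n y =
  (cos (n.+1%:R * (pi * `|x - y|)) / n.+1%:R ^+ 4 -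
   cos (n.+1%:R * (pi * (x + y))) / n.+1%:R ^+ 4) / pi ^+ 4.
Proof.
have -> : cos (n.+1%:R * (pi * `|x - y|)) = cos (n.+1%:R * pi * x - n.+1%:R * pi * y).
  rewrite -[LHS]cos_norm -[RHS]cos_norm -mulrBr; congr cos.
  by rewrite mulrA normrM [RHS]normrM normr_id.
have -> : n.+1%:R * (pi * (x + y)) = n.+1%:R * pi * x + n.+1%:R * pi * y by ring.
rewrite -mulrBl -sinM2 -[2 in RHS](@sqr_sqrtr R 2)//.
have k0 : 0 < n.+1%:R :> R by rewrite ltr0n.
rewrite /phi1; move: (sin (n.+1%:R * pi * x)) (sin (n.+1%:R * pi * y)) => a b.
move: (n.+1%:R : R) k0 (pi : R) (pi_gt0 R) => k k0 p p0.
by field; rewrite !gt_eqF.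
Qed.

Lemma phi1_expansion x y : 0 <= x <= 1 -> 0 <= y <= 1 ->
  \sum_(n < N) phi1 n x * phi1 n y @[N --> \oo] --> K1 x y.
Proof.
move=> /andP[x0 x1] /andP[y0 y1]; have p0 := pi_gt0 R.
have h1 : 0 <= pi * `|x - y| <= pi *+ 2.
  apply/andP; split; first by rewrite mulr_ge0// ltW.
  rewrite -(mulr_natr pi) ler_wpM2l ?(ltW p0)//.
  by rewrite ler_norml; lra.
have h2 : 0 <= pi * (x + y) <= pi *+ 2.
  apply/andP; split. by apply: mulr_ge0; [exact: ltW|exact: addr_ge0].
  rewrite -(mulr_natr pi) ler_wpM2l ?(ltW p0)//.
  lra.
rewrite (_ : (fun N => _) = fun N => (cos_sum N (pi * `|x - y|) - cos_sum N (pi * (x + y))) / pi ^+ 4).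
  apply: cvgMr_tmp; apply: cvgB; exact: cvg_cos_sum_quartic.
apply/funext => N; rewrite /cos_sum -sumrB mulr_suml; apply: eq_bigr => n _.
exact: phi1M.
Qed.

Lemma phi1_weight_le n :
  `|(n.+1%:R ^+ 2 * pi ^+ 2)^-1 * Num.sqrt 2| <= (n.+1%:R ^+ 2)^-1 :> R.
Proof.
have k0 : 0 < n.+1%:R ^+ 2 :> R by rewrite exprn_gt0// ltr0n.
have p2 : 4 <= pi ^+ 2 :> R.
  by rewrite (_ : 4 = 2 ^+ 2 :> R) ?lerXn2r ?nnegrE ?pi_ge0 ?pi_ge2//; ring.
have p20 : 0 < pi ^+ 2 :> R by rewrite exprn_gt0// pi_gt0.
have s2 : Num.sqrt 2 <= 2 :> R.
  by rewrite -(@ler_pXn2r _ 2) ?nnegrE ?sqrtr_ge0// sqr_sqrtr// expr2; lra.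
rewrite ger0_norm ?mulr_ge0 ?sqrtr_ge0 ?invr_ge0 ?(ltW (mulr_gt0 k0 p20))//.
rewrite invfM -[leLHS]mulrA ler_piMr ?invr_ge0 ?(ltW k0)//.
rewrite mulrC ler_pdivrMr// mul1r; lra.
Qed.

Lemma phi1_le n x : `|phi1 n x| <= (n.+1%:R ^+ 2)^-1.
Proof.
rewrite /phi1 mulrA normrM -[leRHS]mulr1 ler_pM// ?phi1_weight_le//.
exact: sin_max.
Qed.

Lemma sum_phi1_le N x : \sum_(n < N) `|phi1 n x| <= 2.
Proof.
by apply: le_trans (sum_invsq_le N); apply: ler_sum => n _; exact: phi1_le.
Qed.

Lemma continuous_phi1 n : continuous (phi1 n).
Proof.
move=> x; apply: cvgMl_tmp; apply: cvgMl_tmp.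
apply: (@continuous_comp R R R (fun x => n.+1%:R * pi * x) sin).
  exact: cvgMl_tmp.
exact: continuous_sin.
Qed.

Lemma sin_natpi_sub m t : sin (m%:R * pi - t) = - ((-1) ^+ m * sin t).
Proof. by rewrite addrC mulr_natl (alternatingn (@sinDpi R)) sinN mulrN. Qed.

(** Dirichlet's formula with M - 1 terms at t = l pi / M: there (M - 1/2) t = l pi - t / 2, and the
    bounds on l put t / 2 in ]0, pi[, so sin (t / 2) can be cancelled. *)
Lemma sum_cos_grid l M : (0 < l < M.*2)%N ->
  \sum_(j < M) cos (l%:R * pi * (j%:R / M%:R)) = (1 - (-1) ^+ l) / 2 :> R.
Proof.
case: M => [|M] /andP[l0 lM]; first by [].
pose t : R := l%:R * pi / M.+1%:R.
have M0 : 0 < M.+1%:R :> R by rewrite ltr0n.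
have st : 0 < sin (t / 2).
  apply: sin_gt0_pi; rewrite /t; apply/andP; split.
    by rewrite !divr_gt0// mulr_gt0 ?pi_gt0// ltr0n.
  rewrite ltr_pdivrMr// ltr_pdivrMr// mulrC -mulrA ltr_pM2l ?pi_gt0//.
  by rewrite -natrM ltr_nat mul2n.
have := dirichlet_kernel M t.
have -> : (M%:R + 2^-1) * t = l%:R * pi - t / 2.
  have -> : M%:R = M.+1%:R - 1 :> R by rewrite -natr1; ring.
  by rewrite /t; field; rewrite gt_eqF.
rewrite sin_natpi_sub => h.
have {}h : 2^-1 + \sum_(n < M) cos (n.+1%:R * t) = - (-1) ^+ l / 2.
  apply: (mulfI (_ : 2 * sin (t / 2) != 0)); first by rewrite gt_eqF// mulr_gt0.
  by rewrite h; field.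
rewrite big_ord_recl/= mul0r mulr0 cos0.
rewrite (eq_bigr (fun n : 'I_M => cos (n.+1%:R * t))) => [|n _]; last first.
  by congr cos; rewrite /t /bump /= add1n; ring.
by move: h; move: (\sum_(n < M) _) ((-1) ^+ l) => S e; lra.
Qed.

(* Discrete orthogonality: exact as soon as M is large, which replaces
   integration against sines in the proof of uniqueness of coefficients. *)
Definition grid_dot (M n m : nat) : R :=
  M%:R^-1 * \sum_(j < M) 2 * (sin (n.+1%:R * pi * (j%:R / M%:R)) *
                              sin (m.+1%:R * pi * (j%:R / M%:R))).

Lemma grid_dotC M n m : grid_dot M n m = grid_dot M m n.
Proof.
by rewrite /grid_dot; congr (_ * _); apply: eq_bigr => j _; congr (_ * _); rewrite mulrC.
Qed.

Lemma grid_dot_le M n m : `|grid_dot M n m| <= 2.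
Proof.
case: M => [|M]; first by rewrite /grid_dot big_ord0 mulr0 normr0.
have M0 : 0 < M.+1%:R :> R by rewrite ltr0n.
rewrite /grid_dot normrM ger0_norm ?invr_ge0// mulrC ler_pdivrMr//.
apply: le_trans (ler_norm_sum _ _ _) _.
rewrite (@le_trans _ _ (\sum_(j < M.+1) 2))//; last by rewrite sumr_const card_ord mulr_natr.
apply: ler_sum => j _; rewrite normrM ger0_norm// ler_piMr// normrM.
by rewrite -[1]mulr1 ler_pM// sin_max.
Qed.

(** For n <> m the difference and the sum n + m + 2 of the shifted indices have the same parity, so
    their grid sums coincide and cancel. For n = m the difference term averages to 1 and the sum,
    being even, contributes 0. *)
Lemma grid_dot_delta M n m : (n + m + 2 < M.*2)%N -> grid_dot M n m = (n == m)%:R.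
Proof.
have neq : forall p q, (p < q)%N -> (p + q + 2 < M.*2)%N -> grid_dot M q p = 0.
  move=> p q pq pqM; rewrite /grid_dot.
  under eq_bigr do rewrite sinM2.
  rewrite sumrB (_ : \sum_(i < M) cos (_ - _) =
     \sum_(j < M) cos ((q - p)%N%:R * pi * (j%:R / M%:R))); last first.
    apply: eq_bigr => j _; congr cos; rewrite -mulrBl -mulrBl; congr (_ * _ * _).
    by rewrite natrB ?(ltnW pq)// -!natr1; ring.
  rewrite (_ : \sum_(i < M) cos (_ + _) =
     \sum_(j < M) cos ((p + q + 2)%N%:R * pi * (j%:R / M%:R))); last first.
    apply: eq_bigr => j _; congr cos; rewrite -mulrDl -mulrDl; congr (_ * _ * _).
    by rewrite !natrD -!natr1; ring.
  have l1 : (0 < q - p < M.*2)%N by lia.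
  have l2 : (0 < p + q + 2 < M.*2)%N by lia.
  rewrite (sum_cos_grid l1) (sum_cos_grid l2).
  rewrite (_ : (p + q + 2 = (q - p) + p.+1.*2)%N); last by lia.
  by rewrite exprD -(signr_odd _ p.+1.*2) odd_double mulr1 subrr mulr0.
have [nm|nm|->] := ltngtP n m => nmM.
- by rewrite grid_dotC neq.
- by rewrite neq// (addnC m).
have M0 : M%:R != 0 :> R by rewrite pnatr_eq0; lia.
rewrite /grid_dot; under eq_bigr do rewrite sinM2 subrr cos0 -mulrDl -mulrDl.
rewrite sumrB sumr_const card_ord.
rewrite (_ : \sum_(i < M) _ =
   \sum_(j < M) cos ((m + m + 2)%N%:R * pi * (j%:R / M%:R))); last first.
  apply: eq_bigr => j _; congr cos; congr (_ * _ * _).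
  by rewrite !natrD -!natr1; ring.
have l1 : (0 < m + m + 2 < M.*2)%N by lia.
rewrite (sum_cos_grid l1).
rewrite addnn addn2 -doubleS -(signr_odd _ m.+1.*2) odd_double subrr mul0r subr0.
by rewrite mulVf.
Qed.

End sine_family.

(** * The kernel as an integral *)

Section tonelli.
Context {R : realType}.
Local Notation T := (measurableTypeR R).
Local Notation leb := (@lebesgue_measure R).

Lemma measurable_prod_tnth n (g : 'I_n -> T -> R) :
  (forall k, measurable_fun setT (g k)) ->
  measurable_fun setT (fun z : n.-tuple T => \prod_(k < n) g k (tnth z k)).
Proof.
move=> mg; apply: measurable_prod => k _.
by apply: (@measurableT_comp _ _ _ _ _ _ (g k)) => //; exact: measurable_tnth.
Qed.

Lemma integral_lebesgue_tuple_prod n (g : 'I_n -> T -> R) :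
  (forall k, measurable_fun setT (g k)) -> (forall k t, 0 <= g k t) ->
  (\int[lebesgue_tuple n]_z (\prod_(k < n) g k (tnth z k))%:E =
   \prod_(k < n) \int[leb]_t (g k t)%:E)%E.
Proof.
elim: n g => [|n IH] g mg g0.
  rewrite big_ord0 /= integral_dirac//; last first.
    by apply/measurable_EFinP; exact: measurable_prod_tnth.
  by rewrite diracT mul1e big_ord0.
pose f (z : n.+1.-tuple T) := (\prod_(k < n.+1) g k (tnth z k))%:E.
have mf : measurable_fun setT f by apply/measurable_EFinP; exact: measurable_prod_tnth.
have f0 z : (0 <= f z)%E by rewrite lee_fin prodr_ge0.
rewrite [LHS](_ : _ = \int[pushforward (leb \x lebesgue_tuple n)%E (@tuple_cons R n)]_z f z)%E//.
have mc : measurable_fun [set: T * n.-tuple T] (@tuple_cons R n).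
  exact: measurable_cons.
rewrite ge0_integral_pushforward//= preimage_setT.
pose h (z : n.-tuple T) := \prod_(k < n) g (lift ord0 k) (tnth z k).
have mh : measurable_fun setT h.
  by apply: (@measurable_prod_tnth n (fun k => g (lift ord0 k))) => k.
have h0 z : 0 <= h z by rewrite prodr_ge0.
have fE z : f (tuple_cons z) = (g ord0 z.1 * h z.2)%:E.
  rewrite /f big_ord_recl; congr (_ * _)%:E.
  by apply: eq_bigr => k _; rewrite tnthS.
under eq_integral do rewrite fE.
rewrite (@fubini_tonelli1 _ _ _ _ R leb (lebesgue_tuple n)
  (fun z : T * n.-tuple T => (g ord0 z.1 * h z.2)%:E))//=; last 2 first.
- apply/measurable_EFinP; apply: measurable_funM.
    exact: (measurableT_comp (mg ord0) measurable_fst).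
  exact: (measurableT_comp mh measurable_snd).
- by move=> z; rewrite lee_fin mulr_ge0.
rewrite big_ord_recl -IH//.
rewrite -ge0_integralZr//; last 3 first.
- exact/measurable_EFinP.
- by move=> t _; rewrite lee_fin.
- by apply: integral_ge0 => z _; rewrite lee_fin; exact: h0.
apply: eq_integral => t _; rewrite /fubini_F/=.
under eq_integral do rewrite EFinM.
rewrite ge0_integralZl//.
- exact/measurable_EFinP.
- by move=> z _; rewrite lee_fin.
- by rewrite lee_fin.
Qed.

End tonelli.

(** * Positive parts and the derivative of their squares *)

Section plus_power.
Context {R : realType}.
Implicit Types (c t x y : R).

Definition pos_part t : R := (t + `|t|) / 2.

Lemma pos_part_ge t : 0 <= t -> pos_part t = t.
Proof. by move=> t0; rewrite /pos_part ger0_norm//; lra. Qed.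

Lemma pos_part_le t : t <= 0 -> pos_part t = 0.
Proof. by move=> t0; rewrite /pos_part ler0_norm// subrr mul0r. Qed.

Lemma mulr_pos_part t : t * pos_part t = pos_part t ^+ 2.
Proof.
have [t0|/ltW t0] := leP 0 t; first by rewrite pos_part_ge.
by rewrite pos_part_le// mulr0 expr0n.
Qed.

Lemma continuous_pos_part : continuous pos_part.
Proof.
move=> t; apply: cvgMr_tmp; apply: cvgD; first exact: cvg_id.
exact: norm_continuous.
Qed.

(** Squaring removes the kink at 0. This permits one antiderivative on all of [0, 1], without
    splitting the integral at x and y. *)
Lemma is_derive_pos_part_sqr t :
  is_derive t 1 (fun s => pos_part s ^+ 2) (2 * pos_part t).
Proof.
have [t0|t0|->] := ltgtP t 0.
- rewrite pos_part_le ?(ltW t0)// mulr0.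
  apply: (@near_eq_is_derive _ _ _ (cst 0)).
  near=> s; rewrite pos_part_le ?expr0n//= ltW//.
  by near: s; exact: lt_nbhsl.
- rewrite pos_part_ge ?(ltW t0)//.
  have dsqr : is_derive t 1 (fun s => s ^+ 2) (2 * t).
    have := is_deriveX 2 (is_derive_id t 1); rewrite exprfctE => /is_derive_eq; apply.
    by rewrite /GRing.scale/= mulr1.
  apply: (near_eq_is_derive _ dsqr).
  near=> s; rewrite pos_part_ge// ltW//.
  by near: s; exact: lt_nbhsr.
rewrite pos_part_le// mulr0.
(* The difference quotient at 0 is [pos_part h] itself, which tends to 0. *)
have d0 : (h^-1 *: (((fun s => pos_part s ^+ 2) \o shift 0) (h *: 1) -
    pos_part 0 ^+ 2)) @[h --> 0^'] --> (0 : R).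
  have : pos_part h @[h --> 0^'] --> pos_part 0.
    by apply: cvg_within_filter; exact: continuous_pos_part.
  rewrite pos_part_le//; apply: cvg_trans; apply: near_eq_cvg; near=> h.
  have h0 : h != 0 by near: h; exact: nbhs_dnbhs_neq.
  rewrite /= addr0 /GRing.scale/= mulr1 expr0n/= subr0 -mulr_pos_part mulrA.
  by rewrite mulVf// mul1r.
by split; [apply/cvg_ex; exists 0|exact: cvg_lim].
Unshelve. all: by end_near. Qed.

End plus_power.

(** * Explicit integration of the one-dimensional kernel and passage to the product *)

Section kernel_integral.
Context {R : realType}.
Implicit Types (x y t : R).
Local Notation leb := (@lebesgue_measure R).

Definition green x t : R := Num.min x t - x * t.

Lemma greenE x t : green x t = (1 - x) * t - pos_part (t - x).
Proof.
rewrite /green /pos_part; have [xt|tx] := leP x t.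
  by rewrite ger0_norm ?subr_ge0//; field.
by rewrite ltr0_norm ?subr_lt0//; field.
Qed.

Lemma greenC x t : green x t = green t x.
Proof. by rewrite /green minC mulrC. Qed.

Lemma green_ge0 x t : 0 <= x <= 1 -> 0 <= t <= 1 -> 0 <= green x t.
Proof.
move=> /andP[x0 x1] /andP[t0 t1]; rewrite /green subr_ge0 le_min.
by rewrite ler_piMr//= ler_piMl.
Qed.

Lemma continuous_green x : continuous (green x).
Proof.
move=> t; rewrite (_ : green x = fun t => (1 - x) * t - pos_part (t - x)).
  apply: cvgB; first exact: cvgMl_tmp.
  apply: (@continuous_comp _ _ _ (fun t => t - x) pos_part).
    by apply: cvgB; [exact: cvg_id|exact: cvg_cst].
  exact: continuous_pos_part.
by apply/funext => s; rewrite greenE.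
Qed.

Lemma continuous_green2 x y : continuous (fun t => green x t * green t y).
Proof.
rewrite (_ : (fun t => _) = fun t => green x t * green y t); last first.
  by apply/funext => t; rewrite (greenC t).
by move=> t; apply: cvgM; exact: continuous_green.
Qed.

(* Writing min x t = t - (t - x)_+ turns green x t * green t y into a combination
   of t ^ 2 and of first and second powers of (t - x)_+ and (t - y)_+. *)
Definition green2_primitive x y t : R :=
  (1 - x) * (1 - y) / 3 * t ^+ 3
  + (- ((1 - y) / 3) * ((t - x) * pos_part (t - x) ^+ 2)
  + (- ((1 - y) * x / 2) * pos_part (t - x) ^+ 2
  + (x / 3 * ((t - y) * pos_part (t - y) ^+ 2)
  + - (x * (1 - y) / 2) * pos_part (t - y) ^+ 2))).

Lemma is_derive_pos_part_sub c t :
  is_derive t 1 (fun s => pos_part (s - c) ^+ 2) (2 * pos_part (t - c)).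
Proof.
have h : is_derive t 1 (fun s => s - c) 1.
  apply: (is_derive_eq (is_deriveB (is_derive_id t 1) (is_derive_cst c t 1))).
  by rewrite subr0.
have := @is_derive1_comp R (fun s => pos_part s ^+ 2) (fun s => s - c) t _ _
  (is_derive_pos_part_sqr (t - c)) h.
by move/is_derive_eq; apply; rewrite mulr1.
Qed.

Lemma is_derive_pos_part_cube c t :
  is_derive t 1 (fun s => (s - c) * pos_part (s - c) ^+ 2) (3 * pos_part (t - c) ^+ 2).
Proof.
have h : is_derive t 1 (fun s => s - c) 1.
  apply: (is_derive_eq (is_deriveB (is_derive_id t 1) (is_derive_cst c t 1))).
  by rewrite subr0.
have := is_deriveM h (is_derive_pos_part_sub c t).
move/is_derive_eq; apply; rewrite /GRing.scale/= mulr1 mulrCA mulr_pos_part; ring.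
Qed.

Lemma is_derive_green2_primitive x y t : x <= y ->
  is_derive t 1 (green2_primitive x y) (green x t * green t y).
Proof.
move=> xy.
have dX : is_derive t 1 (fun s : R => s ^+ 3) (3 * t ^+ 2).
  have := is_deriveX 3 (is_derive_id t 1); rewrite exprfctE => /is_derive_eq; apply.
  by rewrite /GRing.scale/= mulr1.
have := is_deriveD (is_deriveZ ((1 - x) * (1 - y) / 3) dX)
 (is_deriveD (is_deriveZ (- ((1 - y) / 3)) (is_derive_pos_part_cube x t))
 (is_deriveD (is_deriveZ (- ((1 - y) * x / 2)) (is_derive_pos_part_sub x t))
 (is_deriveD (is_deriveZ (x / 3) (is_derive_pos_part_cube y t))
   (is_deriveZ (- (x * (1 - y) / 2)) (is_derive_pos_part_sub y t))))).
move/is_derive_eq; apply; rewrite /GRing.scale/= (greenC t) !greenE.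
have hX := mulr_pos_part (t - x); have hY := mulr_pos_part (t - y).
(* The ordering x <= y enters here: where (t - y)_+ is nonzero, t exceeds x as well. The relations
   [eX], [eY], [eXY] then remove every mixed product, leaving the monomials of the primitive's
   derivative. *)
have hXY : pos_part (t - x) * pos_part (t - y) = (t - x) * pos_part (t - y).
  have [ty|/ltW yt] := leP (t - y) 0; first by rewrite (pos_part_le ty) !mulr0.
  by congr (_ * _); rewrite pos_part_ge//; lra.
move: hX hY hXY; move: (pos_part (t - x)) (pos_part (t - y)) => X Y hX hY hXY.
have eX : t * X = X ^+ 2 + x * X by rewrite -hX; ring.
have eY : t * Y = Y ^+ 2 + y * Y by rewrite -hY; ring.
have eXY : X * Y = Y ^+ 2 + (y - x) * Y by rewrite hXY -hY; ring.
have -> : ((1 - x) * t - X) * ((1 - y) * t - Y) =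
  (1 - x) * (1 - y) * t ^+ 2 - (1 - x) * (t * Y) - (1 - y) * (t * X) + X * Y by ring.
by rewrite eX eY eXY; field.
Qed.

Lemma integral_green2 x y : 0 <= x <= 1 -> 0 <= y <= 1 ->
  (\int[leb]_(t in `[0%R, 1%R]) (green x t * green t y)%:E = (K1 x y)%:E)%E.
Proof.
wlog xy : x y / x <= y => [hw x01 y01|/andP[x0 x1] /andP[y0 y1]].
  have [xy|/ltW yx] := leP x y; first exact: hw.
  rewrite (_ : K1 x y = K1 y x); last by rewrite /K1 distrC (addrC x).
  rewrite -hw//; apply: eq_integral => t _.
  by congr EFin; rewrite mulrC (greenC t y) (greenC x t).
have dH t := is_derive_green2_primitive t xy.
have cH : continuous (green2_primitive x y).
  by move=> t; apply: differentiable_continuous; apply/derivable1_diffP; case: (dH t).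
rewrite (@continuous_FTC2 R _ (green2_primitive x y))//.
- rewrite -EFinB; congr EFin; rewrite /K1 distrC (ger0_norm (_ : 0 <= y - x)) ?subr_ge0//.
  rewrite /green2_primitive !(@pos_part_ge _ (1 - _)) ?subr_ge0//.
  rewrite !(@pos_part_le _ (0 - _)) ?sub0r ?oppr_le0//.
  (* The primitive vanishes at 0; what remains is a polynomial identity in x and y, in which all
     powers of pi cancel. *)
  rewrite /quartic; move: (pi : R) (pi_gt0 R) => p p0.
  by field; rewrite gt_eqF.
- exact/continuous_subspaceT/continuous_green2.
- split=> [t _||]; first by have := dH t; case.
  + exact/cvg_at_right_filter/cH.
  + exact/cvg_at_left_filter/cH.
- by move=> t _; rewrite derive1E; have := dH t; case.
Qed.

Lemma integral_min_kernelE d (x y : set_type (@unit_cube R d)) :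
  integral_min_kernel R d x y = \prod_(k < d) K1 (Defs.coord x k) (Defs.coord y k).
Proof.
have coord01 (u : set_type (@unit_cube R d)) k : 0 <= Defs.coord u k <= 1.
  by have := set_valP u; exact.
(* Truncation to [0, 1] makes the factors nonnegative on the whole line, as Tonelli requires, and
   absorbs the indicator of the cube into the product. *)
pose g k (t : measurableTypeR R) : R :=
  if 0 <= t <= 1 then green (Defs.coord x k) t * green t (Defs.coord y k) else 0.
have g0 k t : 0 <= g k t.
  rewrite /g; case: ifPn => // t01.
  by rewrite mulr_ge0// ?green_ge0// greenC green_ge0.
have gE k : g k = (fun t => green (Defs.coord x k) t * green t (Defs.coord y k)) \_ `[0%R, 1%R].
  apply/funext => t; rewrite /g /patch; case: ifPn => t01.
    by rewrite mem_set.
  by rewrite memNset//= in_itv/=; exact/negP.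
have mg k : measurable_fun setT (g k).
  rewrite gE; apply/(measurable_restrictT _ _).1 => //.
  apply: (measurable_funS measurableT) => //.
  apply: continuous_measurable_fun; exact: continuous_green2.
have Psi_g z : ((fun z => (Psi (Defs.coord x) (tnth z) * Psi (tnth z) (Defs.coord y))%:E) \_
    [set z : d.-tuple R | forall k, 0 <= tnth z k <= 1]) z =
    (\prod_(k < d) g k (tnth z k))%:E.
  rewrite /patch; case: ifPn => [/[!inE] z01|/negP/[!inE] zN01].
    congr EFin; rewrite /Psi -big_split; apply: eq_bigr => k _.
    by rewrite /g z01.
  congr EFin; have [k zk] : exists k, ~~ (0 <= tnth z k <= 1).
    by apply: contra_notP zN01 => h k; apply: contra_notT h => zk; exists k.
  by rewrite (bigD1 k)//= /g (negbTE zk) mul0r.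
rewrite /integral_min_kernel /Rintegral integral_mkcond.
under eq_integral do rewrite Psi_g.
rewrite integral_lebesgue_tuple_prod//.
rewrite (eq_bigr (fun k => (K1 (Defs.coord x k) (Defs.coord y k))%:E)) => [|k _].
  by rewrite -(big_morph EFin (@EFinM R) erefl).
rewrite -integral_green2// [RHS]integral_mkcond; apply: eq_integral => t _.
by rewrite gE /patch; case: ifPn.
Qed.

End kernel_integral.

(** * Multi-indexed products *)

Section boxes.
Context {R : realType} {d : nat}.
Local Notation index := {ffun 'I_d -> nat}.
Implicit Types (u : 'I_d -> nat -> R) (m : index).

Definition box_seq N : seq index :=
  [seq [ffun k => nat_of_ord (f k)] | f : {ffun 'I_d -> 'I_N}].

Definition box N : {fset index} := [fset m in box_seq N]%fset.

Lemma in_box N m : (m \in box N) = [forall k, m k < N]%N.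
Proof.
rewrite inE /box_seq; apply/mapP/forallP => [[f _ -> k]|mN].
  by rewrite ffunE.
exists [ffun k => Ordinal (mN k)]; first by rewrite mem_enum.
by apply/ffunP => k; rewrite !ffunE.
Qed.

Lemma sum_box u N :
  \sum_(m <- box N) \prod_k u k (m k) = \prod_k \sum_(n < N) u k n.
Proof.
have bu : uniq (box_seq N).
  rewrite map_inj_uniq ?enum_uniq// => f g /ffunP fg; apply/ffunP => k.
  by apply/val_inj; have := fg k; rewrite !ffunE.
rewrite (perm_big (box_seq N)); last first.
  by apply: uniq_perm => // [|m]; [exact: fset_uniq|rewrite inE].
rewrite big_image/= bigA_distr_bigA; apply: eq_bigr => f _.
by apply: eq_bigr => k _; rewrite ffunE.
Qed.

Lemma sub_box (J : {fset index}) : exists N, (J `<=` box N)%fset.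
Proof.
exists (\max_(m <- J) \max_k m k).+1; apply/fsubsetP => m mJ.
rewrite in_box; apply/forallP => k; rewrite ltnS.
apply: (leq_trans (leq_bigmax k)); rewrite (big_rem m)//=; exact: leq_maxl.
Qed.

Lemma box_mono M N : (M <= N)%N -> (box M `<=` box N)%fset.
Proof.
move=> MN; apply/fsubsetP => m; rewrite !in_box => /forallP mM.
by apply/forallP => k; exact: leq_trans (mM k) MN.
Qed.

Lemma prod_abs_summable u (C : R) :
  (forall k N, \sum_(n < N) `|u k n| <= C) ->
  abs_summable (fun m => \prod_k u k (m k)).
Proof.
move=> uC; exists (\prod_(k < d) C) => J; have [N JN] := sub_box J.
rewrite (@le_trans _ _ (\sum_(m <- box N) `|\prod_k u k (m k)|))//.
  by rewrite [leRHS](sum_fset_subD _ JN) lerDl sumr_ge0.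
rewrite (eq_bigr (fun m => \prod_k `|u k (m k)|)) => [|m _]; last exact: normr_prod.
rewrite (sum_box (fun k n => `|u k n|)); apply: ler_prod => k _.
by rewrite sumr_ge0//= uC.
Qed.

Lemma cvg_prod_seq {T K : Type} (F : set_system T) {FF : Filter F} (r : seq K)
    (f : K -> T -> R) (l : K -> R) :
  (forall i, f i x @[x --> F] --> l i) ->
  \prod_(i <- r) f i x @[x --> F] --> \prod_(i <- r) l i.
Proof.
move=> fl; elim: r => [|i r IH].
  by rewrite big_nil; under eq_fun do rewrite big_nil; exact: cvg_cst.
rewrite big_cons; under eq_fun do rewrite big_cons.
by apply: cvgM.
Qed.

(** Absolute summability provides a limit along all finite sets; it is identified along the boxes,
    which are cofinal and on which the partial sum factors into one-dimensional ones. *)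
Lemma prod_partial_sum_cvg u (C : R) (U : 'I_d -> R) :
  (forall k N, \sum_(n < N) `|u k n| <= C) ->
  (forall k, \sum_(n < N) u k n @[N --> \oo] --> U k) ->
  summability.partial_sum (fun m => \prod_k u k (m k)) @ summability.totally -->
    \prod_k U k.
Proof.
move=> uC uU; have sc := cvg_partial_sum (prod_abs_summable uC).
have boxT : box N @[N --> \oo] --> summability.totally.
  move=> A [J _ JA]; have [N JN] := sub_box J; exists N => // M /= NM.
  by apply: JA => /=; exact: fsubset_trans JN (box_mono NM).
have h1 := cvg_comp _ _ boxT sc.
have h2 : \prod_k \sum_(n < N) u k n @[N --> \oo] --> \prod_k U k.
  exact: (@cvg_prod_seq _ _ _ _ _ (fun k N => \sum_(n < N) u k n)).
suff -> : \prod_k U k = summability.sum (fun m => \prod_k u k (m k)) by [].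
apply: (cvg_unique _ h2) => //; move: h1.
rewrite (_ : _ \o _ = fun N => \prod_k \sum_(n < N) u k n)//.
by apply/funext => N /=; rewrite partial_sumE sum_box.
Qed.

End boxes.

(** * The product basis on the cube *)

Section basis.
Context {R : realType} {d : nat}.
Local Notation index := {ffun 'I_d -> nat}.
Local Notation cube := (set_type (@unit_cube R d)).
Implicit Types (m : index) (x y : cube).

Lemma phiE m x : phi m x = \prod_(k < d) phi1 (m k) (Defs.coord x k).
Proof. by []. Qed.

Lemma coord_itv x k : 0 <= Defs.coord x k <= 1.
Proof. by have := set_valP x; exact. Qed.

Lemma phi_abs_summable x : abs_summable (fun m => phi m x).
Proof.
apply: (@prod_abs_summable R d (fun k n => phi1 n (Defs.coord x k)) 2) => k N.
exact: sum_phi1_le.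
Qed.

(** A common summable majorant of [phi m x] and of [phi_dot N m m0], independent of x, N and m0; the
    factor 2 comes from [grid_dot_le]. *)
Definition phi_bound m : R := \prod_(k < d) (2 / (m k).+1%:R ^+ 2).

Lemma phi_bound_ge0 m : 0 <= phi_bound m.
Proof. by apply: prodr_ge0 => k _; rewrite divr_ge0// exprn_ge0. Qed.

Lemma phi_bound_summable : abs_summable phi_bound.
Proof.
apply: (@prod_abs_summable R d (fun k n => 2 / n.+1%:R ^+ 2) 4) => k N.
rewrite (eq_bigr (fun n : 'I_N => 2 * (n.+1%:R ^+ 2)^-1)) => [|n _].
  rewrite -mulr_sumr; have := @sum_invsq_le R N; lra.
by rewrite ger0_norm// divr_ge0// exprn_ge0.
Qed.

Lemma phi_le m x : `|phi m x| <= phi_bound m.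
Proof.
rewrite normr_prod; apply: ler_prod => k _; rewrite normr_ge0/=.
rewrite (le_trans (phi1_le _ _))// ler_peMl ?invr_ge0 ?exprn_ge0//; lra.
Qed.

Lemma continuous_phi m : continuous (phi m : cube -> R).
Proof.
move=> x.
apply: (@cvg_prod_seq R cube 'I_d (nbhs x) _ (index_enum _)
  (fun k y => phi1 (m k) (Defs.coord y k)) (fun k => phi1 (m k) (Defs.coord x k))) => k.
apply: (@continuous_comp _ _ _ (fun y : cube => Defs.coord y k) (phi1 (m k))).
  apply: (@continuous_comp _ _ _ (@set_val _ (@unit_cube R d)) (fun v => v ord0 k)).
    exact: initial_continuous.
  exact: coord_continuous.
exact: continuous_phi1.
Qed.

Lemma phi_sum_continuous x (e : R) : 0 < e ->
  \forall y \near x, forall J : {fset index}, \sum_(m <- J) `|phi m x - phi m y| <= e.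
Proof.
(* The tail of the majorant counts twice, once for x and once for y, and the finite part takes the
   remaining e / 2. *)
move=> e0; have e40 : 0 < e / 4 by rewrite divr_gt0.
have [J0 J0e] := abs_summable_tail phi_bound_summable e40.
have : (\sum_(m <- J0) `|phi m x - phi m y|) @[y --> x] --> \sum_(m <- J0) (0 : R).
  apply: (@cvg_sum_seq R cube index (nbhs x) _ (enum_fset J0)
    (fun m y => `|phi m x - phi m y|) (fun=> 0)) => m.
  rewrite -(normr0 R) -(subrr (phi m x)).
  by apply: cvg_norm; apply: cvgB; [exact: cvg_cst|exact: continuous_phi].
rewrite big1// => /cvgr_lt/(_ (e / 2)); rewrite divr_gt0// => /(_ isT).
apply: filterS => y J0y J.
have tl : \sum_(m <- (J `\` J0)%fset) `|phi m x - phi m y| <= e / 2.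
  rewrite (@le_trans _ _ (\sum_(m <- (J `\` J0)%fset) 2 * `|phi_bound m|))//.
    apply: ler_sum => m _; rewrite (le_trans (ler_normB _ _))//.
    have := phi_le m x; have := phi_le m y.
    rewrite (ger0_norm (phi_bound_ge0 m)); lra.
  by rewrite -mulr_sumr; have := J0e J; lra.
rewrite (@le_trans _ _ (\sum_(m <- (J0 `|` J)%fset) `|phi m x - phi m y|))//.
  by rewrite [leRHS](sum_fset_subD _ (fsubsetUr J0 J)) lerDl sumr_ge0.
rewrite (sum_fset_subD _ (fsubsetUl J0 J)).
have -> : ((J0 `|` J) `\` J0 = J `\` J0)%fset by rewrite fsetDUl fsetDv fset0U.
move: J0y tl; set A := \sum_(_ <- J0) _; set B := \sum_(_ <- _) _ => A1 B1; lra.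
Qed.

Lemma grid_in_cube N (j : {ffun 'I_d -> 'I_N}) :
  (\row_k ((j k)%:R / N%:R) : 'rV[R]_d) \in @unit_cube R d.
Proof.
rewrite inE => k; rewrite mxE divr_ge0//=.
have N0 : (0 < N)%N by exact: leq_ltn_trans (ltn_ord (j k)).
by rewrite ler_pdivrMr ?ltr0n// mul1r ler_nat ltnW.
Qed.

Definition grid N (j : {ffun 'I_d -> 'I_N}) : cube := SigSub (grid_in_cube j).

Lemma coord_grid N (j : {ffun 'I_d -> 'I_N}) k :
  Defs.coord (grid j) k = (j k)%:R / N%:R.
Proof. by rewrite /Defs.coord /grid set_valE/= mxE. Qed.

Definition phi_weight m : R :=
  \prod_(k < d) (((m k).+1%:R ^+ 2 * pi ^+ 2)^-1 * Num.sqrt 2).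

(** The discrete sine coefficient of [phi m] at m0, on the grid with N points per axis. It is a
    finite combination of point values, so it applies to expansions that converge only pointwise. *)
Definition phi_dot N m m0 : R := \sum_(j : {ffun 'I_d -> 'I_N})
  (\prod_k (N%:R^-1 * 2 * sin ((m0 k).+1%:R * pi * ((j k)%:R / N%:R)))) *
  phi m (grid j).

Lemma phi_dotE N m m0 :
  phi_dot N m m0 = phi_weight m * \prod_k grid_dot N (m k) (m0 k).
Proof.
rewrite /phi_dot /phi_weight -big_split/=.
pose F k (j : 'I_N) : R := ((m k).+1%:R ^+ 2 * pi ^+ 2)^-1 * Num.sqrt 2 *
  (N%:R^-1 * (2 * (sin ((m k).+1%:R * pi * (j%:R / N%:R)) *
                   sin ((m0 k).+1%:R * pi * (j%:R / N%:R))))).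
rewrite (eq_bigr (fun j : {ffun 'I_d -> 'I_N} => \prod_k F k (j k))) => [|j _].
  rewrite -bigA_distr_bigA; apply: eq_bigr => k _.
  by rewrite /F /grid_dot -!mulr_sumr.
rewrite phiE -big_split; apply: eq_bigr => k _ /=.
by rewrite coord_grid /phi1 /F; ring.
Qed.

Lemma phi_weight_neq0 m : phi_weight m != 0.
Proof.
apply/prodf_neq0 => k _; rewrite gt_eqF// mulr_gt0 ?sqrtr_gt0//.
by rewrite invr_gt0 mulr_gt0// exprn_gt0// ?pi_gt0 ?ltr0n.
Qed.

Lemma phi_dot_le N m m0 : `|phi_dot N m m0| <= phi_bound m.
Proof.
rewrite phi_dotE /phi_weight -big_split/= normr_prod; apply: ler_prod => k _.
rewrite normr_ge0/= normrM mulrC ler_pM// ?grid_dot_le//.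
exact: phi1_weight_le.
Qed.

Lemma phi_dot_delta N m m0 : (forall k, (m k + m0 k + 2 < N.*2)%N) ->
  phi_dot N m m0 = if m == m0 then phi_weight m else 0.
Proof.
move=> mN; rewrite phi_dotE.
rewrite (eq_bigr (fun k => (m k == m0 k)%:R)) => [|k _]; last by rewrite grid_dot_delta.
case: eqP => [->|/eqP mm0]; first by rewrite big1 ?mulr1// => k _; rewrite eqxx.
have [k /negbTE mk] : exists k, m k != m0 k.
  apply/existsP; rewrite -negb_forall; apply: contra mm0 => /forallP h.
  by apply/eqP/ffunP => k; exact/eqP.
by rewrite (bigD1 k)//= mk mul0r mulr0.
Qed.

(** The discrete coefficient at m0, applied to the expansion of 0, isolates a m0 up to aliasing from
    large m. As [phi_bound] controls [phi_dot] uniformly in N, the finite set J0 is fixed first; N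
    is then taken large enough for orthogonality to be exact on J0, and the aliased rest is at most
    |M| + 1 times a tail. *)
Lemma phi_independent (a : index -> R) (M : R) :
  (forall m, `|a m| <= M) -> expands (fun m x => phi m x) a (cst 0 : cube -> R) ->
  a = 0.
Proof.
move=> aM a0; apply/funext => m0; apply/eqP.
rewrite -[_ == _]/(a m0 == 0); suff : a m0 * phi_weight m0 == 0.
  by rewrite mulf_eq0 (negbTE (phi_weight_neq0 m0)) orbF.
rewrite -normr_le0; apply/ler_addgt0Pr => e e0; rewrite add0r.
have M0 : 0 < `|M| + 1 by rewrite ltr_wpDl.
have e1 : 0 < e / 2 / (`|M| + 1) by rewrite !divr_gt0.
have [J0 J0e] := abs_summable_tail phi_bound_summable e1.
(* All entries of m0 and of the members of J0 are below N1, so m k + m0 k + 2 < 2 N. *)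
have [N1 m0N] := sub_box (m0 |` J0)%fset; pose N := (N1 + N1).+2.
have dot0 : \sum_(m <- J) a m * phi_dot N m m0 @[J --> summability.totally] --> (0 : R).
  pose W (j : {ffun 'I_d -> 'I_N}) : R :=
    \prod_k (N%:R^-1 * 2 * sin ((m0 k).+1%:R * pi * ((j k)%:R / N%:R))).
  pose g j J := W j * summability.partial_sum (fun m => a m * phi m (grid j)) J.
  have h (j : {ffun 'I_d -> 'I_N}) : g j J @[J --> summability.totally] --> (0 : R).
    by rewrite -(mulr0 (W j)); apply: cvgMl_tmp; exact: a0.
  have := @cvg_sum_seq R _ _ _ _ (index_enum _) g (fun=> 0) h.
  rewrite big1//.
  rewrite (_ : (fun J => \sum_(j <- _) g j J) =
    fun J : {fset index} => \sum_(m <- J) a m * phi_dot N m m0); first by apply.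
  apply/funext => J; rewrite /g.
  under eq_bigr do rewrite partial_sumE mulr_sumr.
  rewrite exchange_big/=; apply: eq_bigr => m _.
  by rewrite /phi_dot mulr_sumr; apply: eq_bigr => j _; rewrite /W; ring.
have e20 : 0 < e / 2 by rewrite divr_gt0.
have /cvgrPdist_le/(_ _ e20) := dot0.
move=> /nearE_totally[J1 J1e].
pose J := (J1 `|` (m0 |` J0))%fset.
have := J1e J (fsubsetUl _ _); rewrite sub0r normrN.
have m0J : m0 \in (m0 |` J0)%fset by rewrite !inE eqxx.
rewrite (sum_fset_subD _ (fsubsetUr J1 (m0 |` J0)%fset)).
have -> : \sum_(m <- (m0 |` J0)%fset) a m * phi_dot N m m0 = a m0 * phi_weight m0.
  rewrite (big_fsetD1 m0)//= big_seq big1 ?addr0 => [|m].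
    rewrite phi_dot_delta ?eqxx// => k.
    have := (fsubsetP m0N) _ m0J; rewrite in_box => /forallP/(_ k); rewrite /N; lia.
  rewrite in_fsetD1 => /andP[mm0 mJ]; rewrite phi_dot_delta => [|k].
    by rewrite (negbTE mm0) mulr0.
  have := (fsubsetP m0N) _ m0J; rewrite in_box => /forallP/(_ k).
  have := (fsubsetP m0N) _ mJ; rewrite in_box => /forallP/(_ k); rewrite /N; lia.
set tl := \sum_(m <- _) _ => h.
have tle : `|tl| <= e / 2.
  rewrite (le_trans (ler_norm_sum _ _ _))//.
  have J0K : (J0 `<=` m0 |` J0)%fset by exact: fsubsetUr.
  have := J0e (J `\` (m0 |` J0))%fset.
  rewrite fsetDDl (fsetUidPl _ _ J0K) => tail.
  rewrite (@le_trans _ _ (\sum_(m <- (J `\` (m0 |` J0))%fset) (`|M| + 1) * `|phi_bound m|))//.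
    apply: ler_sum => m _; rewrite normrM ler_pM//.
      by rewrite (le_trans (aM m))// (le_trans (ler_norm M))// lerDl.
    by rewrite (le_trans (phi_dot_le _ _ _))// ler_norm.
  by rewrite -mulr_sumr mulrC -ler_pdivlMr.
have := ler_normB (a m0 * phi_weight m0 + tl) tl; rewrite addrK => h'.
by rewrite (le_trans h')// [leRHS]splitr lerD.
Qed.

Lemma integral_min_kernel_expands y :
  expands (fun m x => phi m x) (fun m => phi m y) (integral_min_kernel R d y).
Proof.
move=> x; rewrite integral_min_kernelE.
rewrite (_ : (fun _ => _) = fun m : index =>
  \prod_k (phi1 (m k) (Defs.coord y k) * phi1 (m k) (Defs.coord x k))); last first.
  by apply/funext => m; rewrite !phiE -big_split.
apply: (@prod_partial_sum_cvg R d
  (fun k n => phi1 n (Defs.coord y k) * phi1 n (Defs.coord x k)) 2) => k.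
  move=> N; apply: le_trans (sum_phi1_le N (Defs.coord y k)).
  apply: ler_sum => n _; rewrite normrM ler_piMr// (le_trans (phi1_le _ _))//.
  by rewrite invf_le1 ?exprn_gt0 ?ltr0n// exprn_ege1// ler1n.
by apply: phi1_expansion; exact: coord_itv.
Qed.

End basis.

Theorem corollary4p13 (R : realType) (d : nat) (hd : (0 < d)%N) :
  [/\ exists B : banach_function_space,
        is_BK d 1%E B /\
        right_sided_RKBS B (integral_min_kernel R d),
      forall p : \bar R, (1 < p)%E ->
        exists B : banach_function_space,
          is_BK d p B /\
          two_sided_RKBS B (integral_min_kernel R d) &
      forall p : \bar R, (1 <= p)%E ->
        BK_set d p `<=` [set f | continuous f]].
Proof.
have main p : (1 <= p)%E -> exists B : banach_function_space,
    [/\ is_BK d p B, two_sided_RKBS B (integral_min_kernel R d) &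
      BK_set d p `<=` [set f | continuous f]].
  (* The zero index witnesses that the supremum defining the c_0 norm runs over a nonempty set. *)
  move=> p1; have [N Np] := lp_fset_norm (R := R) ([ffun=> 0%N] : {ffun 'I_d -> nat}) p1.
  exists (expansion_space N (@phi_abs_summable R d) (@phi_sum_continuous R d)
    (@phi_independent R d)).
  split.
  - split=> [|f a pa af]; last first.
      have [tailsP normP] := Np a; rewrite -(normP pa).
      by apply: expansion_space_norm => //; exact/tailsP.
    rewrite expansion_space_range; apply/seteqP.
    by split=> f [a pa af]; exists a => //; apply/(proj1 (Np a)).
  - exact/expansion_space_two_sided/integral_min_kernel_expands.
  - move=> f [a pa af] /=; have ta := (proj1 (Np a)).2 pa.
    exact: (expands_continuous (@phi_sum_continuous R d)
      (coef_small_tails_bounded ta) af).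
split=> [|p p1|p /main[B []]//].
  (* For p = 1 the same dual space is kept, together with the right half of the two-sided
     structure. *)
  have [B [BK [F [iota [iso right _]]] _]] := main 1%E (lexx _).
  by exists B; split=> //; exists F, iota.
by have [B [BK two _]] := main p (ltW p1); exists B.
Qed.
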